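(* Let $B=R_{\mathbf p}(\mathbf u,\boldsymbol\sigma,\mathbf H,\mathbf J)$ and $D=S_{\mathbf q}(\mathbf v,\boldsymbol\varphi,\mathbf K,\mathbf L)$ be BR algebras of ranks $m$ and $n$ with canonical ideals $I^{(\boldsymbol\beta)}$ ($\boldsymbol\beta\in\mathbb Z^m$) and $\mathcal I^{(\boldsymbol\alpha)}$ ($\boldsymbol\alpha\in\mathbb Z^n$), respectively. Suppose each $\sigma_i$ ($i\in[m]$) lifts to an automorphism $\widetilde\sigma_i$ of $R\otimes S$ with $\widetilde\sigma_i(1\otimes\mathcal I^{(\boldsymbol\alpha)})=1\otimes\mathcal I^{(\boldsymbol\alpha)}$ for all $\boldsymbol\alpha\in\mathbb Z^n$, that each $\varphi_k$ ($k\in[n]$) lifts to an automorphism $\widetilde\varphi_k$ of $R\otimes S$ with $\widetilde\varphi_k(I^{(\boldsymbol\beta)}\otimes1)=I^{(\boldsymbol\beta)}\otimes1$ for all $\boldsymbol\beta\in\mathbb Z^m$, and that all the $\widetilde\sigma_i$ and $\widetilde\varphi_k$ commute with one another. Let $d_{ik}\in\Bbbk^\times$ for $i\in[m]$, $k\in[n]$, and let $\tau:D\otimes B\to B\otimes D$ be the twisting map $$\tau(a\,\mathbf v^{\boldsymbol\alpha}\otimes b\,\mathbf u^{\boldsymbol\beta})=d_{\boldsymbol\beta,\boldsymbol\alpha}\,\widetilde{\boldsymbol\varphi}^{\boldsymbol\alpha}(b)\,\mathbf u^{\boldsymbol\beta}\otimes\widetilde{\boldsymbol\sigma}^{-\boldsymbol\beta}(a)\,\mathbf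 v^{\boldsymbol\alpha}\qquad(a\in\mathcal I^{(\boldsymbol\alpha)},\ b\in I^{(\boldsymbol\beta)}),\qquad d_{\boldsymbol\beta,\boldsymbol\alpha}=\prod_{i\in[m],\,k\in[n]}d_{ik}^{\beta_i\alpha_k}.$$ Let $\mathbf r=\begin{pmatrix}\mathbf p&\mathbf d\\ \mathbf d'&\mathbf q\end{pmatrix}\in M_{m+n}(\Bbbk^\times)$ with $\mathbf d=(d_{ik})$ and $\mathbf d'$ the $n\times m$ matrix with $(k,i)$ entry $d_{ik}^{-1}$; let $\boldsymbol\pi=(\widetilde\sigma_1,\dots,\widetilde\sigma_m,\widetilde\varphi_1,\dots,\widetilde\varphi_n)$; and let $$\mathbf M=(H_1\otimes S,\dots,H_m\otimes S,R\otimes K_1,\dots,R\otimes K_n),\qquad\mathbf N=(J_1\otimes S,\dots,J_m\otimes S,R\otimes L_1,\dots,R\otimes L_n).$$ Let $W=(R\otimes S)_{\mathbf r}(\mathbf t,\boldsymbol\pi,\mathbf M,\mathbf N)$ be the corresponding BR algebra of rank $m+n$. Then $B\otimes_\tau D\cong W$ as algebras.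
   Context: All algebras are associative unital algebras over a field $\Bbbk$; $\otimes=\otimes_\Bbbk$; $[n]=\{1,\dots,n\}$. A matrix $\mathbf p=(p_{ik})\in M_n(\Bbbk^\times)$ is multiplicatively antisymmetric if $p_{ik}=p_{ki}^{-1}$ for all $i,k$. BR algebra of rank $n$: given an algebra $R$, commuting automorphisms $\boldsymbol\sigma=(\sigma_1,\dots,\sigma_n)$ and multiplicatively antisymmetric $\mathbf p$, let $R_{\mathbf p}[\mathbf t^{\pm1};\boldsymbol\sigma]$ be the iterated skew Laurent extension generated over $R$ by $t_1^{\pm1},\dots,t_n^{\pm1}$ with $t_i^{\pm1}r=\sigma_i^{\pm1}(r)t_i^{\pm1}$ and $t_kt_i=p_{ik}t_it_k$ for $i\ne k$. Let $\mathbf H=(H_1,\dots,H_n)$, $\mathbf J=(J_1,\dots,J_n)$ be two-sided ideals of $R$. Put $I_i^{(k)}=J_i\sigma_i(J_i)\cdots\sigma_i^{k-1}(J_i)$ for $k>0$, $I_i^{(0)}=R$, $I_i^{(k)}=\sigma_i^{-1}(H_i)\cdots\sigma_i^{k}(H_i)$ for $k<0$. Assume that $\sigma_i(H_k)=H_k$, $\sigma_i(J_k)=J_k$, $H_iH_k=H_kH_i$, $H_iJ_k=J_kH_i$, $J_iJ_k=J_kJ_i$ for $i\ne k$, and $I_i^{(k)}\neq0$ for all $i,k$. The canonical ideals are $I^{(\boldsymbol\alpha)}=I_1^{(\alpha_1)}\cdots I_n^{(\alpha_n)}$, and $R_{\mathbf p}(\mathbf t,\boldsymbol\sigma,\mathbf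 H,\mathbf J)=\bigoplus_{\boldsymbol\alpha\in\mathbb Z^n}I^{(\boldsymbol\alpha)}\mathbf t^{\boldsymbol\alpha}\subset R_{\mathbf p}[\mathbf t^{\pm1};\boldsymbol\sigma]$, with $\mathbf t^{\boldsymbol\alpha}=t_1^{\alpha_1}\cdots t_n^{\alpha_n}$. In the claim the Laurent variables for $B$ are $u_1,\dots,u_m$ and for $D$ are $v_1,\dots,v_n$. ''$\sigma_i$ lifts to $\widetilde\sigma_i$'' means $\widetilde\sigma_i(r\otimes1)=\sigma_i(r)\otimes1$ for $r\in R$; similarly $\widetilde\varphi_k(1\otimes s)=1\otimes\varphi_k(s)$. By the hypothesis with $\boldsymbol\alpha=\mathbf 0$ (resp. $\boldsymbol\beta=\mathbf0$), $\widetilde\sigma_i$ restricts to an automorphism of $S\cong1\otimes S$ and $\widetilde\varphi_k$ to an automorphism of $R\cong R\otimes1$; these restrictions are denoted by the same symbols. Also $\widetilde{\boldsymbol\varphi}^{\boldsymbol\alpha}=\widetilde\varphi_1^{\alpha_1}\cdots\widetilde\varphi_n^{\alpha_n}$ and $\widetilde{\boldsymbol\sigma}^{-\boldsymbol\beta}=\widetilde\sigma_1^{-\beta_1}\cdots\widetilde\sigma_m^{-\beta_m}$. For a $\Bbbk$-linear $\tau:D\otimes B\to B\otimes D$ with $\tau(d\otimes1)=1\otimes d$, $\tau(1\otimes b)=b\otimes1$ and satisfying the associativity condition, $B\otimes_\tau D$ is the vector space $B\otimes D$ with multiplication $(\mu_B\otimes\mu_D)\circ(\mathrm{id}_B\otimes\tau\otimes\mathrm{id}_D)$,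 where $\mu_B,\mu_D$ are the multiplications of $B,D$; the map $\tau$ of the claim satisfies this condition. *)

(* Defs.v *)
From HB Require Import structures.
From mathcomp Require Import all_boot all_order all_algebra.
From mathcomp Require Import boolp classical_sets.
From mathcomp Require Import finmap monalg.

Set Implicit Arguments.
Unset Strict Implicit.
Unset Printing Implicit Defensive.

Import GRing.Theory.

Local Open Scope classical_set_scope.
Local Open Scope ring_scope.

Section Bilinear.
Variable k : fieldType.

Definition bilinear_map (U V W : lmodType k) (f : U -> V -> W) : Prop :=
  (forall v, linear (f^~ v)) /\ (forall u, linear (f u)).

Lemma linear_map_sum (U W : lmodType k) (f : U -> W) (I : Type) (r : seq I) (F : I -> U) :
  linear f -> f (\sum_(i <- r) F i) = \sum_(i <- r) f (F i).
Proof.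
move=> lf; have f0 : f 0 = 0.
  by have := lf (-1) 0 0; rewrite scaler0 addr0 scaleN1r addNr.
by apply: big_morph => // x y; have := lf 1 x y; rewrite !scale1r.
Qed.

Lemma linear_mapZ (U W : lmodType k) (f : U -> W) c u : linear f -> f (c *: u) = c *: f u.
Proof.
move=> lf; have f0 : f 0 = 0.
  by have := lf (-1) 0 0; rewrite scaler0 addr0 scaleN1r addNr.
by have := lf c u 0; rewrite !addr0 f0 addr0.
Qed.

Lemma linear_map0 (U W : lmodType k) (f : U -> W) : linear f -> f 0 = 0.
Proof. by move=> lf; rewrite -(scale0r 0) linear_mapZ // scale0r. Qed.

Lemma linear_mapD (U W : lmodType k) (f : U -> W) u v : linear f -> f (u + v) = f u + f v.
Proof. by move=> lf; have := lf 1 u v; rewrite !scale1r. Qed.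
End Bilinear.

Lemma exists_functional (k : fieldType) (V : lmodType k) (v : V) : v != 0 ->
  exists f : {linear V -> k^o}, f v = 1.
Proof.
move=> v0.
pose P (X : set V) := ~ X v /\ forall (a : k) x y, X x -> X y -> X (a *: x + y).
have [F FP Ftot|M [[Mv Mlin] Mmax]] := @Zorn_bigcup V P.
  split=> [[X FX Xv]|a x y [X FX Xx] [Y FY Yy]]; first by have [] := FP X FX.
  have [XY|YX] := Ftot X Y FX FY.
    by exists Y => //; have [_] := FP Y FY; apply=> //; apply: XY.
  by exists X => //; have [_] := FP X FX; apply=> //; apply: YX.
have M0 : M 0.
  apply: contrapT => nM0.
  have nM x : ~ M x.
    by move=> Mx; apply: nM0; have := Mlin (-1) x x Mx Mx; rewrite scaleN1r addNr.
  apply: (Mmax [set 0]).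
    rewrite properEneq; split; last by move=> x /nM.
    by apply/eqP => E; apply: nM0; rewrite E.
  split=> [/eqP|a x y -> ->]; first by rewrite (negPf v0).
  by rewrite scaler0 addr0.
have MZ a x : M x -> M (a *: x) by move=> Mx; rewrite -[_ *: _]addr0; apply: Mlin.
have MD x y : M x -> M y -> M (x + y).
  by move=> Mx; rewrite -[x in _ (x + _)]scale1r; apply: Mlin.
have MB x y : M x -> M y -> M (x - y).
  by move=> Mx My; rewrite addrC -scaleN1r; apply: Mlin.
have dec w : exists c, M (w - c *: v).
  apply: contrapT => nw.
  have Mw : ~ M w by move=> Mw; apply: nw; exists 0; rewrite scale0r subr0.
  apply: (Mmax [set z | exists c, M (z - c *: w)]).
    rewrite properEneq; split; last by move=> x Mx; exists 0; rewrite scale0r subr0.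
    by apply/eqP => E; apply: Mw; rewrite E; exists 1; rewrite scale1r subrr.
  split=> [[c Mc]|a x y [c Mc] [d Md]].
    have [c0|c0] := eqVneq c 0; first by apply: Mv; rewrite c0 scale0r subr0 in Mc.
    apply: nw; exists c^-1; have := MZ (- c^-1) _ Mc.
    by rewrite scalerBr scalerA mulNr mulVf // !scaleNr scale1r opprK addrC.
  exists (a * c + d); have := Mlin a _ _ Mc Md.
  by rewrite scalerBr scalerDl opprD addrACA scalerA.
have uni w c d : M (w - c *: v) -> M (w - d *: v) -> c = d.
  move=> Mc Md; apply/eqP; rewrite -subr_eq0; apply/negPn/negP => cd.
  apply: Mv; have /(MZ (c - d)^-1) := MB _ _ Md Mc.
  by rewrite opprD opprK addrACA subrr add0r addrC -scalerBl scalerA mulVf // scale1r.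
pose f w : k^o := xget 0 [set c | M (w - c *: v)].
have fP w : M (w - f w *: v).
  by rewrite /f; case: xgetP => [c _ //|]; have [c Mc] := dec w; move=> /(_ c).
have flin : linear f.
  move=> a x y; apply: (@uni (a *: x + y)); first exact: fP.
  have := Mlin a _ _ (fP x) (fP y).
  by rewrite scalerBr scalerDl opprD addrACA scalerA.
pose F : {linear V -> k^o} := HB.pack_for {linear V -> k^o} f (GRing.isLinear.Build k V k^o *:%R f flin).
exists F; rewrite /F /=.
by apply: (@uni v); [exact: fP|rewrite scale1r subrr].
Qed.

Section TensorDef.
Local Open Scope quotient_scope.
Variables (k : fieldType) (U V : lmodType k).

(* The tensor product is the free k-module on U * V modulo the k-span of tensor_rel *)
Local Notation free := {malg k[(U * V)%type]}.

Inductive tensor_rel : free -> Prop :=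
| TensorRelL a u u' v :
    tensor_rel (<<(a *: u + u', v)>> - (a *: <<(u, v)>> + <<(u', v)>>))
| TensorRelR a u v v' :
    tensor_rel (<<(u, a *: v + v')>> - (a *: <<(u, v)>> + <<(u, v')>>)).

Inductive tensor_null : free -> Prop :=
| TensorNull0 : tensor_null 0
| TensorNullP a x y : tensor_rel x -> tensor_null y -> tensor_null (a *: x + y).

Lemma tensor_nullD x y : tensor_null x -> tensor_null y -> tensor_null (x + y).
Proof.
elim=> [|a x' y' rx' ny' IH] ny; first by rewrite add0r.
by rewrite -addrA; apply: TensorNullP => //; apply: IH.
Qed.

Lemma tensor_null_rel x : tensor_rel x -> tensor_null x.
Proof. by move=> rx; rewrite -[x]addr0 -[x]scale1r; apply: TensorNullP rx TensorNull0. Qed.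

Lemma tensor_nullZ a x : tensor_null x -> tensor_null (a *: x).
Proof.
elim=> [|b x' y' rx' ny' IH]; first by rewrite scaler0; apply: TensorNull0.
by rewrite scalerDr scalerA; apply: TensorNullP.
Qed.

Definition tensor_null_pred : {pred free} := fun x => `[< tensor_null x >].

Lemma tensor_null_zmod : zmod_closed tensor_null_pred.
Proof.
split; first exact/asboolP/TensorNull0.
move=> x y /asboolP nx /asboolP ny; apply/asboolP; rewrite -scaleN1r.
by apply: tensor_nullD => //; apply: tensor_nullZ.
Qed.

HB.instance Definition _ := GRing.isZmodClosed.Build free tensor_null_pred tensor_null_zmod.

Definition tquot := @Quotient.quot free tensor_null_pred.
Definition tensor : Type := tquot.
HB.instance Definition _ := GRing.Zmodule.copy tensor tquot.

Definition tpi (x : free) : tensor := \pi_tquot x.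

Lemma tpiD x y : tpi (x + y) = tpi x + tpi y.
Proof. exact: (@raddfD _ _ \pi_tquot). Qed.

Lemma tpi0 : tpi 0 = 0.
Proof. exact: (@raddf0 _ _ \pi_tquot). Qed.

Lemma tpiP x y : tpi x = tpi y <-> tensor_null (x - y).
Proof.
rewrite /tpi; split=> [/eqP|n].
  by rewrite -Quotient.idealrBE => /asboolP.
by apply/eqP; rewrite -Quotient.idealrBE; apply/asboolP.
Qed.

Definition trepr (x : tensor) : free := repr (x : tquot).
Lemma treprK x : tpi (trepr x) = x.
Proof. exact: reprK. Qed.

Definition tscale (c : k) (x : tensor) : tensor := tpi (c *: trepr x).

Lemma tscaleE c x : tscale c (tpi x) = tpi (c *: x).
Proof.
apply/tpiP; rewrite -scalerBr; apply: tensor_nullZ; apply/tpiP; exact: treprK.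
Qed.

Fact tscaleA a b v : tscale a (tscale b v) = tscale (a * b) v.
Proof. by rewrite -[v]treprK !tscaleE scalerA. Qed.
Fact tscale1 : left_id 1 tscale.
Proof. by move=> v; rewrite -[v]treprK !tscaleE scale1r. Qed.
Fact tscaleDr : right_distributive tscale +%R.
Proof. by move=> a u v; rewrite -[u]treprK -[v]treprK -tpiD !tscaleE scalerDr tpiD. Qed.
Fact tscaleDl v : {morph tscale^~ v : a b / a + b}.
Proof. by move=> a b; rewrite -[v]treprK !tscaleE scalerDl tpiD. Qed.

HB.instance Definition _ :=
  GRing.Zmodule_isLmodule.Build k tensor tscaleA tscale1 tscaleDr tscaleDl.

Lemma tpiZ c x : tpi (c *: x) = c *: tpi x.
Proof. by rewrite -tscaleE. Qed.

Fact tens_key : unit. Proof. by []. Qed.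
Definition tens : U -> V -> tensor := locked_with tens_key (fun u v => tpi <<(u, v)>>).

Lemma tensE u v : tens u v = tpi <<(u, v)>>.
Proof. by rewrite /tens unlock. Qed.

End TensorDef.

Arguments tensor {k} U V.
Arguments tens {k U V} u v.

Notation "u *t v" := (tens u v) (at level 40, left associativity) : ring_scope.

Section TensorTheory.
Variables (k : fieldType) (U V : lmodType k).
Implicit Types (u : U) (v : V).

Lemma tens_bilinear : bilinear_map (@tens k U V).
Proof.
split=> [v a u u'|u a v v']; rewrite ?tensE -tpiZ -tpiD; apply/tpiP.
  exact/tensor_null_rel/TensorRelL.
exact/tensor_null_rel/TensorRelR.
Qed.

Lemma tensor_free_gen (x : {malg k[(U * V)%type]}) :
  tpi x = \sum_(p <- msupp x) x@_p *: (p.1 *t p.2).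
Proof.
rewrite {1}[x]monalgE (big_morph (@tpi k U V) (@tpiD _ _ _) (@tpi0 k U V)).
apply: eq_bigr => -[u v] _ /=; rewrite ?tensE -tpiZ; congr tpi.
by apply/malgP => q; rewrite mcoeffZ !mcoeffU mulr_natr.
Qed.

Lemma tensorE (x : tensor U V) :
  exists s : seq (k * U * V), x = \sum_(p <- s) p.1.1 *: (p.1.2 *t p.2).
Proof.
exists [seq ((trepr x)@_p, p.1, p.2) | p <- enum_fset (msupp (trepr x))].
by rewrite big_map -[x in LHS]treprK tensor_free_gen.
Qed.

Lemma tensor_ind (P : tensor U V -> Prop) :
  (forall u v, P (u *t v)) -> (forall c x y, P x -> P y -> P (c *: x + y)) -> forall x, P x.
Proof.
move=> Pt PD x; have [s ->] := tensorE x.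
have P0 : P 0 by have := PD (-1) _ _ (Pt 0 0) (Pt 0 0); rewrite scaleN1r addNr.
elim: s => [|p s IH]; first by rewrite big_nil.
by rewrite big_cons; apply: PD.
Qed.

Lemma tensor_ext (W : lmodType k) (f g : tensor U V -> W) :
  linear f -> linear g -> (forall u v, f (u *t v) = g (u *t v)) -> f =1 g.
Proof.
move=> lf lg fg; apply: tensor_ind => // c x y fx fy.
by rewrite lf lg fx fy.
Qed.

(* For bilinear f, the linear map with tlift f (u *t v) = f u v, see tliftE *)
Fact tlift_key : unit. Proof. by []. Qed.
Definition tlift (W : lmodType k) : (U -> V -> W) -> tensor U V -> W :=
  locked_with tlift_key
    (fun f x => \sum_(p <- msupp (trepr x)) (trepr x)@_p *: f p.1 p.2).

Lemma tlift_def (W : lmodType k) (f : U -> V -> W) x :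
  tlift f x = \sum_(p <- msupp (trepr x)) (trepr x)@_p *: f p.1 p.2.
Proof. by rewrite /tlift unlock. Qed.

Section Lift.
Variables (W : lmodType k) (f : U -> V -> W).
Hypothesis bf : bilinear_map f.

Let ff (x : {malg k[(U * V)%type]}) : W := \sum_(p <- msupp x) x@_p *: f p.1 p.2.

Let ffw (d : {fset (U * V)%type}) x : (msupp x `<=` d)%fset ->
  ff x = \sum_(p <- d) x@_p *: f p.1 p.2.
Proof.
move=> le_d; apply/big_fset_incl => // p _ /mcoeff_outdom ->.
by rewrite scale0r.
Qed.

Let ffP : linear ff.
Proof.
move=> c x y; pose d := (msupp (c *: x + y) `|` (msupp x `|` msupp y))%fset.
rewrite !(@ffw d) ?fsubsetUl //.
- rewrite scaler_sumr -big_split /=; apply: eq_bigr => p _.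
  by rewrite mcoeffD mcoeffZ scalerDl scalerA.
- by rewrite fsubsetU // fsubsetUr orbT.
- by rewrite fsubsetU // fsubsetUl orbT.
Qed.

Let ffU p : ff <<p>> = f p.1 p.2.
Proof.
rewrite (@ffw [fset p]%fset) ?msuppU_le // big_seq_fset1 mcoeffUU scale1r //.
Qed.

Let ff_null x : tensor_null x -> ff x = 0.
Proof.
have ff0 : ff 0 = 0 by rewrite /ff msupp0 big_seq_fset0.
elim=> // a {}x y rx _ IH; rewrite ffP IH addr0.
suff -> : ff x = 0 by rewrite scaler0.
case: rx => [b u u' v|b u v v'];
  rewrite addrC -scaleN1r !ffP !ffU /= ?(bf.1 v b) ?(bf.2 u b) scaleN1r addNr //.
Qed.

Lemma tlift_pi x : tlift f (tpi x) = ff x.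
Proof.
have n : tensor_null (-1 *: x + trepr (tpi x)).
  by rewrite scaleN1r addrC; apply/tpiP/treprK.
have := ff_null n; rewrite ffP scaleN1r addrC => /eqP; rewrite subr_eq0 => /eqP <-.
exact: tlift_def.
Qed.

Lemma tlift_linear : linear (tlift f).
Proof.
move=> c x y; rewrite -[x]treprK -[y]treprK -tpiZ -tpiD !tlift_pi.
exact: ffP.
Qed.

Lemma tliftE u v : tlift f (u *t v) = f u v.
Proof. by rewrite tensE tlift_pi ffU. Qed.
End Lift.

Lemma tens_neq0 u v : u != 0 -> v != 0 -> u *t v != 0.
Proof.
move=> /exists_functional [f fu] /exists_functional [g gv].
pose h u v : k^o := f u * g v.
have bh : bilinear_map h.
  split=> [w a x y|w a x y]; rewrite /h linearP.
    by rewrite mulrDl -scalerAl.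
  by rewrite mulrDr -scalerAr.
apply/eqP => uv0; have := tliftE bh u v.
rewrite uv0 /h fu gv mulr1.
have -> : tlift h 0 = 0.
  by rewrite -(scale0r 0) (linear_mapZ _ _ (tlift_linear bh)) scale0r.
by move/eqP; rewrite eq_sym oner_eq0.
Qed.
End TensorTheory.

Section Linearity.
Variable k : fieldType.
Implicit Types U V W : lmodType k.

Lemma linear_comb U W (f g : U -> W) c :
  linear f -> linear g -> linear (fun x => c *: f x + g x).
Proof.
by move=> lf lg a x y; rewrite lf lg !scalerDr !scalerA (mulrC c) addrACA.
Qed.

Lemma linear_comp U V W (f : V -> W) (g : U -> V) :
  linear f -> linear g -> linear (fun x => f (g x)).
Proof. by move=> lf lg a x y; rewrite lg lf. Qed.

Lemma tensl_linear U V (v : V) : linear (fun u : U => u *t v).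
Proof. exact: (tens_bilinear U V).1. Qed.

Lemma tensr_linear U V (u : U) : linear (fun v : V => u *t v).
Proof. exact: (tens_bilinear U V).2. Qed.

Definition tlift2 U V U' V' W (F : U -> V -> U' -> V' -> W) (x : tensor U V) (y : tensor U' V') : W :=
  tlift (fun u v => tlift (F u v) y) x.

Lemma tlift_sum U V W (f : U -> V -> W) c (g : U -> V -> W) x :
  tlift (fun u v => c *: f u v + g u v) x = c *: tlift f x + tlift g x.
Proof.
rewrite !tlift_def scaler_sumr -big_split /=; apply: eq_bigr => p _.
by rewrite scalerDr !scalerA mulrC.
Qed.

Lemma tlift_linearP U V U' W (F : U' -> U -> V -> W) x :
  (forall u v, linear (fun w => F w u v)) -> linear (fun w => tlift (F w) x).
Proof.
move=> lF c w w'; rewrite -tlift_sum; congr (tlift _ x).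
by apply/funext => u; apply/funext => v; rewrite lF.
Qed.

Section Tlift2.
Variables (U V U' V' W : lmodType k) (F : U -> V -> U' -> V' -> W).
Hypothesis F1 : forall u v, bilinear_map (F u v).
Hypothesis F2 : forall u' v', bilinear_map (fun u v => F u v u' v').

Lemma tlift2_bil1 y : bilinear_map (fun u v => tlift (F u v) y).
Proof.
by split=> w; apply: tlift_linearP => u' v'; [exact: (F2 u' v').1|exact: (F2 u' v').2].
Qed.

Lemma tlift2_bilinear : bilinear_map (tlift2 F).
Proof.
split=> [y|x]; first exact: tlift_linear (tlift2_bil1 y).
by apply: tlift_linearP => u v; apply: tlift_linear.
Qed.

Lemma tlift2E u v u' v' : tlift2 F (u *t v) (u' *t v') = F u v u' v'.
Proof. by rewrite /tlift2 (tliftE (tlift2_bil1 _)) tliftE. Qed.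

Lemma tlift2El u v y : tlift2 F (u *t v) y = tlift (F u v) y.
Proof. by rewrite /tlift2 (tliftE (tlift2_bil1 _)). Qed.
End Tlift2.

End Linearity.

Section TwistedMul.
Variables (k : fieldType) (B D : algType k).

(* b (x *t y) d = (b x) *t (y d) *)
Definition sandwich (b : B) (x : tensor B D) (d : D) : tensor B D :=
  tlift (fun b' d' => (b * b') *t (d' * d)) x.

(* (mu_B (x) mu_D) o (id_B (x) tau (x) id_D), that is
   (b *t d) (b' *t d') = b tau(d *t b') d', see twisted_mulE *)
Definition twisted_mul (tau : tensor D B -> tensor B D) (x y : tensor B D) : tensor B D :=
  tlift2 (fun b d b' d' => sandwich b (tau (d *t b')) d') x y.

Lemma mull_linear (R : algType k) (a : R) : linear (fun x : R => a * x).
Proof. by move=> c x y; rewrite mulrDr scalerAr. Qed.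
Lemma mulr_linear (R : algType k) (a : R) : linear (fun x : R => x * a).
Proof. by move=> c x y; rewrite mulrDl scalerAl. Qed.

Lemma sandwich_bil b d : bilinear_map (fun b' d' => (b * b') *t (d' * d) : tensor B D).
Proof.
split=> [d'|b'].
  exact: (linear_comp (tensl_linear (d' * d)) (mull_linear b)).
exact: (linear_comp (tensr_linear (b * b')) (mulr_linear d)).
Qed.

Lemma sandwich_linear b d : linear (fun x => sandwich b x d).
Proof. exact: tlift_linear (sandwich_bil b d). Qed.

Lemma sandwichE b b' d' d : sandwich b (b' *t d') d = (b * b') *t (d' * d).
Proof. exact: tliftE (sandwich_bil b d) _ _. Qed.

Lemma sandwich_linearl x d : linear (fun b => sandwich b x d).
Proof.
apply: tlift_linearP => b' d'.
exact: (linear_comp (tensl_linear (d' * d)) (mulr_linear b')).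
Qed.

Lemma sandwich_linearr x b : linear (fun d => sandwich b x d).
Proof.
apply: tlift_linearP => b' d'.
exact: (linear_comp (tensr_linear (b * b')) (mull_linear d')).
Qed.

Lemma sandwichM b c x d e : sandwich b (sandwich c x d) e = sandwich (b * c) x (d * e).
Proof.
move: x; apply: tensor_ext => [||u v]; rewrite ?sandwichE ?mulrA //.
  exact: linear_comp (sandwich_linear _ _) (sandwich_linear _ _).
exact: sandwich_linear.
Qed.

Lemma sandwich1 x : sandwich 1 x 1 = x.
Proof.
move: x; apply: tensor_ext => [||u v]; rewrite ?sandwichE ?mul1r ?mulr1 //.
exact: sandwich_linear.
Qed.

Section Linear.
Variable tau : {linear tensor D B -> tensor B D}.
Local Notation M := (twisted_mul tau).
Local Notation F := (fun b d b' d' => sandwich b (tau (d *t b')) d').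

Lemma twisted_mulF1 u v : bilinear_map (F u v).
Proof.
split=> [d|b]; last exact: sandwich_linearr.
apply: (linear_comp (g := fun b => tau (v *t b)) (sandwich_linear u d)).
exact: (linear_comp (f := tau) (fun c x y => linearP _ _ _ _) (tensr_linear v)).
Qed.

Lemma twisted_mulF2 u' v' : bilinear_map (fun u v => F u v u' v').
Proof.
split=> [d|b]; first exact: sandwich_linearl.
apply: (linear_comp (g := fun d => tau (d *t u')) (sandwich_linear b v')).
exact: (linear_comp (f := tau) (fun c x y => linearP _ _ _ _) (tensl_linear u')).
Qed.

Lemma twisted_mul_bilinear : bilinear_map M.
Proof. exact: tlift2_bilinear twisted_mulF1 twisted_mulF2. Qed.

Lemma twisted_mulE b d b' d' :
  M (b *t d) (b' *t d') = sandwich b (tau (d *t b')) d'.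
Proof. exact: (tlift2E twisted_mulF1 twisted_mulF2). Qed.

Lemma twist_mul_bil d b' :
  bilinear_map (fun x y => M (tau (d *t x)) (tau (y *t b'))).
Proof.
split=> w.
  apply: (linear_comp (g := fun x => tau (d *t x)) (twisted_mul_bilinear.1 _)).
  exact: (linear_comp (f := tau) (fun c x y => linearP _ _ _ _) (tensr_linear d)).
apply: (linear_comp (g := fun y => tau (y *t b')) (twisted_mul_bilinear.2 _)).
exact: (linear_comp (f := tau) (fun c x y => linearP _ _ _ _) (tensl_linear b')).
Qed.
End Linear.

Record twistingMap := TwistingMap {
  twist_fun :> {linear tensor D B -> tensor B D};
  twist_1r : forall d, twist_fun (d *t 1) = 1 *t d;
  twist_1l : forall b, twist_fun (1 *t b) = b *t 1;
  (* tau o (mu_D (x) mu_B) =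
     (mu_B (x) mu_D) o (id (x) tau (x) id) o (tau (x) tau) o (id (x) tau (x) id)
     evaluated at d *t d' *t b *t b' *)
  twist_mul : forall d d' b b',
    twist_fun ((d * d') *t (b * b')) =
    tlift (fun x y => twisted_mul twist_fun (twist_fun (d *t x)) (twist_fun (y *t b')))
          (twist_fun (d' *t b))
}.

(* The twisted tensor product, with multiplication twisted_mul tau *)
Definition twisted (tau : twistingMap) : Type := tensor B D.

Section Theory.
Variable tau : twistingMap.
Local Notation twisted := (twisted tau).
Local Notation M := (twisted_mul tau).
Local Notation twisted_mul_bilinear := (twisted_mul_bilinear tau).

Lemma twisted_mul_sandwich b x y d :
  M (sandwich b x 1) (sandwich 1 y d) = sandwich b (M x y) d.
Proof.
move: x; apply: tensor_ext => [||b1 d1].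
- exact: linear_comp (twisted_mul_bilinear.1 _) (sandwich_linear _ _).
- exact: linear_comp (sandwich_linear _ _) (twisted_mul_bilinear.1 _).
move: y; apply: tensor_ext => [||b2 d2].
- exact: linear_comp (twisted_mul_bilinear.2 _) (sandwich_linear _ _).
- exact: linear_comp (sandwich_linear _ _) (twisted_mul_bilinear.2 _).
by rewrite !sandwichE !twisted_mulE mul1r mulr1 sandwichM.
Qed.

Lemma twisted_mul1l : left_id (1 *t 1) M.
Proof.
apply: tensor_ext => [||b d] //; first exact: (twisted_mul_bilinear.2 _).
by rewrite twisted_mulE twist_1l sandwichE !mul1r.
Qed.

Lemma twisted_mul1r : right_id (1 *t 1) M.
Proof.
apply: tensor_ext => [||b d] //; first exact: (twisted_mul_bilinear.1 _).
by rewrite twisted_mulE twist_1r sandwichE !mulr1.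
Qed.

Lemma twisted_mul_mid x d2 b3 :
  M (sandwich 1 x d2) (b3 *t 1) = M x (tau (d2 *t b3)).
Proof.
move: x; apply: tensor_ext => [||b d].
- exact: linear_comp (twisted_mul_bilinear.1 _) (sandwich_linear _ _).
- exact: (twisted_mul_bilinear.1 _).
rewrite sandwichE mul1r twisted_mulE.
have := twist_mul tau d d2 1 b3; rewrite mul1r twist_1r.
rewrite (tliftE (twist_mul_bil tau _ _)) twist_1r => ->.
have -> : b *t d = sandwich b (1 *t d) 1 by rewrite sandwichE !mulr1.
by rewrite -[tau (d2 *t b3)]sandwich1 twisted_mul_sandwich sandwich1.
Qed.

Lemma twisted_mul_mid' y d1 b2 :
  M (1 *t d1) (sandwich b2 y 1) = M (tau (d1 *t b2)) y.
Proof.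
move: y; apply: tensor_ext => [||b d].
- exact: linear_comp (twisted_mul_bilinear.2 _) (sandwich_linear _ _).
- exact: (twisted_mul_bilinear.2 _).
rewrite sandwichE mulr1 twisted_mulE.
have := twist_mul tau d1 1 b2 b; rewrite mulr1 twist_1l.
rewrite (tliftE (twist_mul_bil tau _ _)) twist_1l => ->.
have -> : b *t d = sandwich 1 (b *t 1) d by rewrite sandwichE !mul1r.
by rewrite -[tau (d1 *t b2)]sandwich1 twisted_mul_sandwich sandwich1.
Qed.

Lemma twisted_mulA : associative M.
Proof.
move=> x y z; move: x; apply: tensor_ext => [||b1 d1].
- exact: (twisted_mul_bilinear.1 _).
- exact: linear_comp (twisted_mul_bilinear.1 _) (twisted_mul_bilinear.1 _).
move: y; apply: tensor_ext => [||b2 d2].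
- exact: linear_comp (twisted_mul_bilinear.2 _) (twisted_mul_bilinear.1 _).
- exact: linear_comp (twisted_mul_bilinear.1 _) (twisted_mul_bilinear.2 _).
move: z; apply: tensor_ext => [||b3 d3].
- exact: linear_comp (twisted_mul_bilinear.2 _) (twisted_mul_bilinear.2 _).
- exact: (twisted_mul_bilinear.2 _).
rewrite !twisted_mulE.
have -> : b1 *t d1 = sandwich b1 (1 *t d1) 1 :> tensor B D by rewrite sandwichE !mulr1.
have -> : b3 *t d3 = sandwich 1 (b3 *t 1) d3 :> tensor B D by rewrite sandwichE !mul1r.
have -> : sandwich b2 (tau (d2 *t b3)) d3 = sandwich 1 (sandwich b2 (tau (d2 *t b3)) 1) d3.
  by rewrite sandwichM !mul1r.
have -> : sandwich b1 (tau (d1 *t b2)) d2 = sandwich b1 (sandwich 1 (tau (d1 *t b2)) d2) 1.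
  by rewrite sandwichM !mulr1.
by rewrite !twisted_mul_sandwich twisted_mul_mid' twisted_mul_mid.
Qed.

Lemma tens1_neq0 : 1 *t 1 != 0 :> tensor B D.
Proof. by apply: tens_neq0; apply: oner_neq0. Qed.

HB.instance Definition _ := GRing.Lmodule.copy twisted (tensor B D).

HB.instance Definition _ := GRing.Zmodule_isNzRing.Build twisted
  twisted_mulA twisted_mul1l twisted_mul1r
  (fun x y z => linear_mapD x y (twisted_mul_bilinear.1 z))
  (fun x y z => linear_mapD y z (twisted_mul_bilinear.2 x)) tens1_neq0.

Fact twisted_scaleAl (a : k) (x y : twisted) : a *: (x * y) = (a *: x) * y.
Proof. exact/esym/(linear_mapZ a x (twisted_mul_bilinear.1 y)). Qed.
HB.instance Definition _ := GRing.Lmodule_isLalgebra.Build k twisted twisted_scaleAl.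

Fact twisted_scaleAr (a : k) (x y : twisted) : a *: (x * y) = x * (a *: y).
Proof. exact/esym/(linear_mapZ a y (twisted_mul_bilinear.2 x)). Qed.
HB.instance Definition _ := GRing.Lalgebra_isAlgebra.Build k twisted twisted_scaleAr.

End Theory.
End TwistedMul.

(* The usual algebra structure on tensor R S is the twisted one for the flip; see tensM *)
Section TensorAlg.
Variables (k : fieldType) (R S : algType k).

Lemma flip_bil : bilinear_map (fun (s : S) (r : R) => r *t s).
Proof. by split=> w; [exact: tensr_linear|exact: tensl_linear]. Qed.

Definition flip : tensor S R -> tensor R S := tlift (fun s r => r *t s).
HB.instance Definition _ := GRing.isLinear.Build k (tensor S R) (tensor R S) *:%R flip
  (tlift_linear flip_bil).

Lemma flipE s r : flip (s *t r) = r *t s.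
Proof. exact: tliftE flip_bil _ _. Qed.

Fact flip_mul (s s' : S) (r r' : R) :
  flip ((s * s') *t (r * r')) =
  tlift (fun x y => twisted_mul flip (flip (s *t x)) (flip (y *t r'))) (flip (s' *t r)).
Proof.
by rewrite !flipE (tliftE (twist_mul_bil flip s r')) /= !flipE twisted_mulE /= flipE sandwichE.
Qed.

Definition flip_twist : twistingMap R S :=
  @TwistingMap k R S flip (fun s => flipE s 1) (flipE 1) flip_mul.

HB.instance Definition _ := GRing.Zmodule_isNzRing.Build (tensor R S)
  (twisted_mulA flip_twist) (twisted_mul1l flip_twist) (twisted_mul1r flip_twist)
  (fun x y z => linear_mapD x y ((twisted_mul_bilinear flip_twist).1 z))
  (fun x y z => linear_mapD y z ((twisted_mul_bilinear flip_twist).2 x)) (tens1_neq0 R S).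
HB.instance Definition _ := GRing.Lmodule_isLalgebra.Build k (tensor R S)
  (@twisted_scaleAl _ _ _ flip_twist).
HB.instance Definition _ := GRing.Lalgebra_isAlgebra.Build k (tensor R S)
  (@twisted_scaleAr _ _ _ flip_twist).

Lemma tens1 : 1 *t 1 = 1 :> tensor R S. Proof. by []. Qed.

Lemma tensM (r r' : R) (s s' : S) :
  (r *t s) * (r' *t s') = (r * r') *t (s * s').
Proof.
have flE : flip_twist (s *t r') = r' *t s by exact: flipE.
by rewrite [LHS](twisted_mulE flip_twist) flE sandwichE.
Qed.

End TensorAlg.

Section Aut.
Variables (k : fieldType) (A : algType k).

Record algAut := AlgAut {
  aut_map :> {lrmorphism A -> A};
  aut_inv : A -> A;
  aut_mapK : cancel aut_map aut_inv;
  aut_invK : cancel aut_inv aut_map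
}.

(* s ^ z for z : int *)
Definition autz (s : algAut) (z : int) : A -> A :=
  match z with Posz m => iter m s | Negz m => iter m.+1 (aut_inv s) end.

(* s_1 ^ a_1 \o ... \o s_n ^ a_n *)
Definition autv n (s : 'I_n -> algAut) (a : {ffun 'I_n -> int}) : A -> A :=
  \big[comp/id]_(i < n) autz (s i) (a i).

Definition aut_commute n (s : 'I_n -> algAut) : Prop :=
  forall i j x, s i (s j x) = s j (s i x).

Definition alg_endo (f : A -> A) : Prop :=
  [/\ linear f, f 1 = 1 & forall x y, f (x * y) = f x * f y].

Lemma alg_endo_id : alg_endo id. Proof. by []. Qed.

Lemma alg_endo_comp f g : alg_endo f -> alg_endo g -> alg_endo (f \o g).
Proof.
move=> [fL f1 fM] [gL g1 gM]; split=> [c x y||x y] /=; first by rewrite gL fL.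
  by rewrite g1.
by rewrite gM fM.
Qed.

Lemma alg_endo_iter f m : alg_endo f -> alg_endo (iter m f).
Proof.
move=> fE; elim: m => [|m IH]; first exact: alg_endo_id.
exact: (alg_endo_comp fE IH).
Qed.

Lemma alg_endo_aut (s : algAut) : alg_endo s.
Proof.
split; [by move=> c x y; rewrite linearP|exact: rmorph1|exact: rmorphM].
Qed.

Lemma alg_endo_inv (s : algAut) : alg_endo (aut_inv s).
Proof.
have inj := can_inj (aut_mapK s).
split=> [c x y||x y]; apply: inj.
- by rewrite aut_invK linearP /= !aut_invK.
- by rewrite aut_invK rmorph1.
by rewrite rmorphM /= !aut_invK.
Qed.

Lemma alg_endo_autz s z : alg_endo (autz s z).
Proof.
by case: z => m; apply: alg_endo_iter; [exact: alg_endo_aut|exact: alg_endo_inv].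
Qed.

Lemma alg_endo_autv n (s : 'I_n -> algAut) a : alg_endo (autv s a).
Proof.
rewrite /autv; apply: big_ind; [exact: alg_endo_id|exact: alg_endo_comp|].
by move=> i _; apply: alg_endo_autz.
Qed.

Lemma autz0 s x : autz s 0 x = x. Proof. by []. Qed.
Lemma autz1 s x : autz s 1 x = s x. Proof. by []. Qed.

Lemma autzS s z x : autz s (1 + z) x = s (autz s z x).
Proof.
case: z => [m|[|m]] //; first by rewrite /= aut_invK.
have -> : 1 + Negz m.+1 = Negz m.
  by rewrite !NegzE -[m.+2]addn1 PoszD opprD addrCA subrr addr0.
by rewrite [in RHS]/= aut_invK.
Qed.

Lemma autzB s z x : autz s (-1 + z) x = aut_inv s (autz s z x).
Proof. by have := autzS s (-1 + z) x; rewrite addrA subrr add0r => ->; rewrite aut_mapK. Qed.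

Lemma autzD s y z x : autz s (y + z) x = autz s y (autz s z x).
Proof.
elim: y => [|m IH|m IH]; first by rewrite add0r.
  by rewrite intS -addrA !autzS IH.
by rewrite intS opprD -addrA !autzB IH.
Qed.

Lemma autzN s z : cancel (autz s z) (autz s (- z)).
Proof. by move=> x; rewrite -autzD addNr. Qed.

Lemma autzC (s t : algAut) y z : (forall x, s (t x) = t (s x)) ->
  forall x, autz s y (autz t z x) = autz t z (autz s y x).
Proof.
move=> st.
have st1 w x : s (autz t w x) = autz t w (s x).
  elim: w => [|m IH|m IH] //; first by rewrite intS !autzS st IH.
  rewrite intS opprD !autzB; apply: (can_inj (aut_mapK t)).
  by rewrite -st !aut_invK.
move=> x; elim: y => [|m IH|m IH] //; first by rewrite intS !autzS IH st1.
rewrite intS opprD !autzB; apply: (can_inj (aut_mapK s)).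
by rewrite st1 !aut_invK.
Qed.

Section Vect.
Variables (n : nat) (s : 'I_n -> algAut).
Hypothesis sC : aut_commute s.
Implicit Types a b : {ffun 'I_n -> int}.

Lemma autv0 x : autv s 0 x = x.
Proof. by rewrite /autv; elim/big_rec: _ => //= i f _ fx; rewrite ffunE. Qed.

Lemma autv_autzC a i z x : autv s a (autz (s i) z x) = autz (s i) z (autv s a x).
Proof.
rewrite /autv; elim/big_rec: _ => //= j f _ fx.
by rewrite fx (autzC _ _ (sC j i)).
Qed.

Lemma autvD a b x : autv s (a + b) x = autv s a (autv s b x).
Proof.
have hC (r : seq 'I_n) c j z y :
    (\big[comp/id]_(i <- r) autz (s i) (c i)) (autz (s j) z y) =
    autz (s j) z ((\big[comp/id]_(i <- r) autz (s i) (c i)) y).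
  elim: r y => [|i r IH] y; first by rewrite !big_nil.
  by rewrite !big_cons /= IH (autzC _ _ (sC i j)).
rewrite /autv; elim: (index_enum _) x => [|i r IH] x; first by rewrite !big_nil.
by rewrite !big_cons /= ffunE autzD IH hC.
Qed.

Lemma autvN a : cancel (autv s a) (autv s (- a)).
Proof. by move=> x; rewrite -autvD addNr autv0. Qed.

Definition delta i (z : int) : {ffun 'I_n -> int} := [ffun j => if j == i then z else 0].

Lemma deltaD i y z : delta i (y + z) = delta i y + delta i z.
Proof. by apply/ffunP => j; rewrite !ffunE; case: eqP; rewrite ?addr0. Qed.

Lemma delta0 i : delta i 0 = 0.
Proof. by apply/ffunP => j; rewrite !ffunE; case: eqP. Qed.

Lemma sum_delta a : a = \sum_i delta i (a i).
Proof.
apply/ffunP => j; rewrite sum_ffunE (bigD1 j) //= ffunE eqxx big1 ?addr0 //.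
by move=> i ij; rewrite ffunE eq_sym (negPf ij).
Qed.

Lemma autv_delta i z x : autv s (delta i z) x = autz (s i) z x.
Proof.
rewrite /autv.
rewrite (eq_bigr (fun j => if j == i then autz (s i) z else id)); last first.
  by move=> j _; rewrite ffunE; case: eqP => [->|].
have H r : uniq r ->
    (\big[comp/id]_(j <- r) (if j == i then autz (s i) z else id)) x =
    if i \in r then autz (s i) z x else x.
  elim: r => [|j r IH] /=; first by rewrite big_nil.
  case/andP=> jr /IH {}IH; rewrite big_cons in_cons /= IH eq_sym.
  by case: eqP jr => [<- /negPf ->|].
by rewrite H ?index_enum_uniq // mem_index_enum.
Qed.
End Vect.

End Aut.

Definition mult_antisym (k : fieldType) n (p : 'M[k]_n) : Prop :=
  forall i j, p i j != 0 /\ p i j = (p j i)^-1.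

Record skewData (k : fieldType) (A : algType k) (n : nat) := SkewData {
  sk_p : 'M[k]_n;
  sk_aut : 'I_n -> algAut A;
  sk_antisym : mult_antisym sk_p;
  sk_comm : aut_commute sk_aut
}.

(* R_p[t^(+-1); sigma]: finitely supported families (x_a), standing for \sum_a x_a t^a.
   The multiplication below is forced by the relations t_i^(+-1) r = sigma_i^(+-1)(r) t_i^(+-1)
   and t_j t_i = p_ij t_i t_j; see sgen_coef, sgen_comm, smonoE and slaurentE. *)
Definition slaurent (k : fieldType) (A : algType k) (n : nat) (X : skewData A n) : Type :=
  {malg A[{ffun 'I_n -> int}]}.

Section SkewLaurent.
Variables (k : fieldType) (A : algType k) (n : nat) (X : skewData A n).
Local Notation midx := {ffun 'I_n -> int}.
Local Notation p := (sk_p X).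
Local Notation slaurent := (slaurent X).
Implicit Types a b c : midx.

(* t^a t^b = skew_coef a b t^(a + b): moving t_i^(b_i) to the left of t_j^(a_j), i < j,
   with t_j t_i = p_ij t_i t_j *)
Definition skew_coef a b : k :=
  \prod_(i < n) \prod_(j < n | (i < j)%N) p i j ^ (a j * b i).

Lemma skew_coef_neq0 a b : skew_coef a b != 0.
Proof.
apply/prodf_neq0 => i _; apply/prodf_neq0 => j _.
by rewrite expfz_eq0 negb_and (sk_antisym X i j).1 orbT.
Qed.

Lemma skew_coefDl a a' b : skew_coef (a + a') b = skew_coef a b * skew_coef a' b.
Proof.
rewrite /skew_coef -big_split; apply: eq_bigr => i _ /=.
rewrite -big_split; apply: eq_bigr => j _ /=.
by rewrite ffunE mulrDl expfzDr // (sk_antisym X i j).1.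
Qed.

Lemma skew_coefDr a b b' : skew_coef a (b + b') = skew_coef a b * skew_coef a b'.
Proof.
rewrite /skew_coef -big_split; apply: eq_bigr => i _ /=.
rewrite -big_split; apply: eq_bigr => j _ /=.
by rewrite ffunE mulrDr expfzDr // (sk_antisym X i j).1.
Qed.

Lemma skew_coef0l b : skew_coef 0 b = 1.
Proof. by rewrite /skew_coef !big1 // => i _; rewrite big1 // => j _; rewrite ffunE mul0r. Qed.

Lemma skew_coef0r a : skew_coef a 0 = 1.
Proof. by rewrite /skew_coef !big1 // => i _; rewrite big1 // => j _; rewrite ffunE mulr0. Qed.

Lemma skew_coefA a b c :
  skew_coef a b * skew_coef (a + b) c = skew_coef b c * skew_coef a (b + c).
Proof. by rewrite skew_coefDl skew_coefDr mulrA mulrC. Qed.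


HB.instance Definition _ := GRing.Zmodule.copy slaurent {malg A[midx]}.

Fact smono_key : unit. Proof. by []. Qed.
Definition smono : A -> midx -> slaurent := locked_with smono_key (fun r a => mkmalgU a r).
Lemma smono_def r a : smono r a = mkmalgU a r. Proof. by rewrite /smono unlock. Qed.

Fact scoef_key : unit. Proof. by []. Qed.
Definition scoef : midx -> slaurent -> A :=
  locked_with scoef_key (fun a (x : {malg A[midx]}) => mcoeff a x).
Lemma scoef_def a x : scoef a x = mcoeff a (x : {malg A[midx]}).
Proof. by rewrite /scoef unlock. Qed.

Local Notation supp x := (msupp (x : {malg A[midx]})).

Lemma slaurentP (x y : slaurent) : (forall a, scoef a x = scoef a y) <-> x = y.
Proof.
split=> [xy|->//]; apply: (malgP (x : {malg A[midx]}) y).1 => a.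
by rewrite -!scoef_def.
Qed.

Lemma scoefD a : {morph scoef a : x y / x + y}.
Proof. by move=> x y; rewrite !scoef_def; apply: mcoeffD. Qed.

Lemma scoef0 a : scoef a 0 = 0.
Proof. by rewrite scoef_def; apply: mcoeff0. Qed.

Lemma scoef_mono a r b : scoef a (smono r b) = if b == a then r else 0.
Proof. by rewrite scoef_def smono_def mcoeffU; case: eqP. Qed.

Lemma smonoD a : {morph smono^~ a : r s / r + s}.
Proof. by move=> r s; rewrite !smono_def; apply: monalgUD. Qed.

Lemma smono0 a : smono 0 a = 0.
Proof. by rewrite smono_def; apply: monalgU0. Qed.

Lemma scoef_sum a (I : Type) (r : seq I) (P : pred I) (F : I -> slaurent) :
  scoef a (\sum_(i <- r | P i) F i) = \sum_(i <- r | P i) scoef a (F i).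
Proof. exact: (big_morph _ (scoefD a) (scoef0 a)). Qed.

Lemma slaurentE (x : slaurent) : x = \sum_(a <- supp x) smono (scoef a x) a.
Proof.
rewrite [LHS](monalgE (x : {malg A[midx]})).
by apply: eq_bigr => a _; rewrite smono_def scoef_def.
Qed.

Lemma slaurent_ind (P : slaurent -> Prop) :
  P 0 -> (forall r a x, P x -> P (smono r a + x)) -> forall x, P x.
Proof.
move=> P0 PD x; rewrite [x]slaurentE; elim/big_rec: _ => // a y _; exact: PD.
Qed.

Lemma slaurent_ext (W : zmodType) (f g : slaurent -> W) :
  f 0 = g 0 -> {morph f : x y / x + y} -> {morph g : x y / x + y} ->
  (forall r a, f (smono r a) = g (smono r a)) -> f =1 g.
Proof.
move=> fg0 fD gD fg; apply: slaurent_ind => // r a x fgx.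
by rewrite fD gD fg fgx.
Qed.

Section Ext.
Variables (W : zmodType) (f : A -> midx -> W).
Hypothesis f0 : forall a, f 0 a = 0.
Hypothesis fD : forall a r s, f (r + s) a = f r a + f s a.

Definition sext (x : slaurent) : W := \sum_(a <- supp x) f (scoef a x) a.

Lemma sextw (d : {fset midx}) x : (supp x `<=` d)%fset ->
  sext x = \sum_(a <- d) f (scoef a x) a.
Proof.
move=> le_d; apply/big_fset_incl => // a _ /mcoeff_outdom xa.
by rewrite scoef_def xa f0.
Qed.

Lemma sextD : {morph sext : x y / x + y}.
Proof.
move=> x y; pose d := (supp (x + y)%R `|` (supp x `|` supp y))%fset.
rewrite !(@sextw d) ?fsubsetUl //.
- by rewrite -big_split /=; apply: eq_bigr => a _; rewrite scoefD fD.
- by rewrite fsubsetU // fsubsetUr orbT.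
- by rewrite fsubsetU // fsubsetUl orbT.
Qed.

Lemma sext_mono r a : sext (smono r a) = f r a.
Proof.
rewrite (@sextw [fset a]%fset) ?smono_def ?msuppU_le // big_seq_fset1.
by rewrite -smono_def scoef_mono eqxx.
Qed.

Lemma sext0 : sext 0 = 0.
Proof. by rewrite /sext msupp0 big_seq_fset0. Qed.
End Ext.

Definition sscale (c : k) (x : slaurent) : slaurent :=
  \sum_(a <- supp x) smono (c *: scoef a x) a.

Lemma sscaleE (c : k) x a : scoef a (sscale c x) = c *: scoef a x.
Proof.
move: x; apply: (@slaurent_ext A (fun x => scoef a (sscale c x)) (fun x => c *: scoef a x)).
- by rewrite /sscale msupp0 big_seq_fset0 scoef0 scaler0.
- move=> x y; rewrite -scoefD; congr scoef.
  apply: (sextD (f := fun r a => smono (c *: r) a)) => [b|b r s].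
    by rewrite scaler0 smono0.
  by rewrite scalerDr smonoD.
- by move=> x y; rewrite scoefD scalerDr.
move=> r b; rewrite [sscale _ _](sext_mono (f := fun r a => smono (c *: r) a)).
  by rewrite !scoef_mono; case: eqP; rewrite ?scaler0.
by move=> d; rewrite scaler0 smono0.
Qed.

Fact sscaleA (a b : k) v : sscale a (sscale b v) = sscale (a * b) v.
Proof. by apply/slaurentP => d; rewrite !sscaleE scalerA. Qed.
Fact sscale1 : left_id 1 sscale.
Proof. by move=> v; apply/slaurentP => d; rewrite sscaleE scale1r. Qed.
Fact sscaleDr : right_distributive sscale +%R.
Proof. by move=> a u v; apply/slaurentP => d; rewrite !(scoefD, sscaleE) scalerDr. Qed.
Fact sscaleDl v : {morph sscale^~ v : a b / a + b}.
Proof. by move=> a b; apply/slaurentP => d; rewrite !(scoefD, sscaleE) scalerDl. Qed.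

HB.instance Definition _ :=
  GRing.Zmodule_isLmodule.Build k slaurent sscaleA sscale1 sscaleDr sscaleDl.

Lemma scoefZ a (c : k) (x : slaurent) : scoef a (c *: x) = c *: scoef a x.
Proof. exact: sscaleE. Qed.

Lemma smonoZ a (c : k) r : smono (c *: r) a = c *: smono r a.
Proof. by apply/slaurentP => b; rewrite scoefZ !scoef_mono; case: eqP; rewrite ?scaler0. Qed.

(* (r t^a) (s t^b) = r (sigma^a s) t^a t^b *)
Definition smul1 r a s b : slaurent :=
  smono (skew_coef a b *: (r * autv (sk_aut X) a s)) (a + b).

Fact smul_key : unit. Proof. by []. Qed.
Definition smul : slaurent -> slaurent -> slaurent := locked_with smul_key (fun x y =>
  \sum_(a <- supp x) \sum_(b <- supp y) smul1 (scoef a x) a (scoef b y) b).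
Lemma smul_def x y : smul x y =
  \sum_(a <- supp x) \sum_(b <- supp y) smul1 (scoef a x) a (scoef b y) b.
Proof. by rewrite /smul unlock. Qed.

Local Notation "s ^^ a" := (autv (sk_aut X) a s) (at level 10).

Let autL a : linear (autv (sk_aut X) a). Proof. by case: (alg_endo_autv (sk_aut X) a). Qed.
Let autv1 a : 1 ^^ a = 1. Proof. by case: (alg_endo_autv (sk_aut X) a). Qed.
Let autvM a r s : (r * s) ^^ a = r ^^ a * s ^^ a.
Proof. by case: (alg_endo_autv (sk_aut X) a). Qed.
Let autvDr a r s : (r + s) ^^ a = r ^^ a + s ^^ a.
Proof. exact: linear_mapD (autL a). Qed.
Let autvZ a (c : k) r : (c *: r) ^^ a = c *: r ^^ a.
Proof. exact: linear_mapZ (autL a). Qed.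
Let autvr0 a : 0 ^^ a = 0.
Proof. by have := autvZ a 0 0; rewrite !scale0r. Qed.

Let smul1_0l a s b : smul1 0 a s b = 0.
Proof. by rewrite /smul1 mul0r scaler0 smono0. Qed.
Let smul1_0r a r b : smul1 r a 0 b = 0.
Proof. by rewrite /smul1 autvr0 mulr0 scaler0 smono0. Qed.
Let smul1_Dl a r r' s b : smul1 (r + r') a s b = smul1 r a s b + smul1 r' a s b.
Proof. by rewrite /smul1 mulrDl scalerDr smonoD. Qed.
Let smul1_Dr a r s s' b : smul1 r a (s + s') b = smul1 r a s b + smul1 r a s' b.
Proof. by rewrite /smul1 autvDr mulrDr scalerDr smonoD. Qed.

Lemma smulDl : left_distributive smul +%R.
Proof.
move=> x y z; rewrite !smul_def.
apply: (sextD (f := fun r a => \sum_(b <- supp z) smul1 r a (scoef b z) b)) => [a|a r s].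
  by rewrite big1 // => b _; rewrite smul1_0l.
by rewrite -big_split; apply: eq_bigr => b _; rewrite smul1_Dl.
Qed.

Lemma smul_exch x y :
  smul x y = \sum_(b <- supp y) \sum_(a <- supp x) smul1 (scoef a x) a (scoef b y) b.
Proof. by rewrite smul_def; apply: exchange_big. Qed.

Lemma smulDr : right_distributive smul +%R.
Proof.
move=> z x y; rewrite !smul_exch.
apply: (sextD (f := fun s b => \sum_(a <- supp z) smul1 (scoef a z) a s b)) => [a|a r s].
  by rewrite big1 // => b _; rewrite smul1_0r.
by rewrite -big_split; apply: eq_bigr => b _; rewrite smul1_Dr.
Qed.

Lemma smul_mono r a s b : smul (smono r a) (smono s b) = smul1 r a s b.
Proof.
rewrite smul_def [LHS](sext_mono (f := fun r a =>
  \sum_(c <- supp (smono s b)) smul1 r a (scoef c (smono s b)) c)).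
  by rewrite [LHS](sext_mono (f := fun s b => smul1 r a s b)).
by move=> c; rewrite big1 // => d _; rewrite smul1_0l.
Qed.

Lemma smul0l : left_zero 0 smul.
Proof. by move=> x; rewrite smul_def msupp0 big_seq_fset0. Qed.
Lemma smul0r : right_zero 0 smul.
Proof. by move=> x; rewrite smul_exch msupp0 big_seq_fset0. Qed.

Lemma smulA : associative smul.
Proof.
move=> x y z; elim/slaurent_ind: x => [|r a x IH]; first by rewrite !smul0l.
rewrite !smulDl IH; congr (_ + _); clear x IH.
elim/slaurent_ind: y => [|s b y IH]; first by rewrite !(smul0l, smul0r).
rewrite !(smulDl, smulDr) IH; congr (_ + _); clear y IH.
elim/slaurent_ind: z => [|t c z IH]; first by rewrite !smul0r.
rewrite !smulDr IH; congr (_ + _); clear z IH.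
rewrite !smul_mono /smul1 ?smul_mono /smul1 addrA; congr (smono _ _).
rewrite autvZ autvM -scalerAr -scalerAl !scalerA (autvD (@sk_comm _ _ _ X)) -mulrA.
by rewrite [X in _ = X *: _]mulrC skew_coefA mulrC.
Qed.

Lemma smul1l : left_id (smono 1 0) smul.
Proof.
apply: slaurent_ext => [|x y|x y|r a] //; first by rewrite smul0r.
  by rewrite smulDr.
by rewrite smul_mono /smul1 skew_coef0l autv0 mul1r scale1r add0r.
Qed.

Lemma smul1r : right_id (smono 1 0) smul.
Proof.
apply: slaurent_ext => [|x y|x y|r a] //; first by rewrite smul0l.
  by rewrite smulDl.
by rewrite smul_mono /smul1 skew_coef0r autv1 mulr1 scale1r addr0.
Qed.

Lemma smono1_neq0 : smono 1 0 != 0.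
Proof.
apply/eqP => /slaurentP/(_ 0); rewrite scoef_mono scoef0 eqxx => /eqP.
by rewrite oner_eq0.
Qed.

HB.instance Definition _ := GRing.Zmodule_isNzRing.Build slaurent
  smulA smul1l smul1r smulDl smulDr smono1_neq0.

Lemma smonoM r a s b :
  smono r a * smono s b = smono (skew_coef a b *: (r * s ^^ a)) (a + b).
Proof. exact: smul_mono. Qed.

Fact sscaleAl (c : k) (x y : slaurent) : c *: (x * y) = (c *: x) * y.
Proof.
elim/slaurent_ind: x => [|r a x IH]; first by rewrite !(mul0r, scaler0).
rewrite !(mulrDl, scalerDr) IH; congr (_ + _); clear x IH.
elim/slaurent_ind: y => [|s b y IH]; first by rewrite !(mulr0, scaler0).
rewrite !(mulrDr, scalerDr) IH; congr (_ + _); clear y IH.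
by rewrite -!smonoZ !smonoM -smonoZ -scalerAl !scalerA mulrC.
Qed.
HB.instance Definition _ := GRing.Lmodule_isLalgebra.Build k slaurent sscaleAl.

Fact sscaleAr (c : k) (x y : slaurent) : c *: (x * y) = x * (c *: y).
Proof.
elim/slaurent_ind: x => [|r a x IH]; first by rewrite !(mul0r, scaler0).
rewrite !(mulrDl, scalerDr) IH; congr (_ + _); clear x IH.
elim/slaurent_ind: y => [|s b y IH]; first by rewrite !(mulr0, scaler0).
rewrite !(mulrDr, scalerDr) IH; congr (_ + _); clear y IH.
by rewrite -!smonoZ !smonoM -smonoZ autvZ -scalerAr !scalerA mulrC.
Qed.
HB.instance Definition _ := GRing.Lalgebra_isAlgebra.Build k slaurent sscaleAr.

(* t_i^z *)
Definition sgen (i : 'I_n) (z : int) : slaurent := smono 1 (delta i z).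

Lemma sgen0 i : sgen i 0 = 1.
Proof. by rewrite /sgen delta0. Qed.

Lemma skew_coef_delta i y z : skew_coef (delta i y) (delta i z) = 1.
Proof.
rewrite /skew_coef big1 // => i' _; rewrite big1 // => j ij.
rewrite !ffunE; case: eqP => [ji|_]; last by rewrite mul0r.
by case: eqP => [ii|_]; [move: ij; rewrite ji ii ltnn|rewrite mulr0].
Qed.

Lemma sgenD i y z : sgen i (y + z) = sgen i y * sgen i z.
Proof.
by rewrite /sgen smonoM autv1 mulr1 skew_coef_delta scale1r -deltaD.
Qed.

Lemma sgen_coef i z r : sgen i z * smono r 0 = smono (autz (sk_aut X i) z r) 0 * sgen i z.
Proof.
rewrite !smonoM skew_coef0l skew_coef0r !scale1r autv0 mul1r mulr1 add0r addr0.
by rewrite autv_delta.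
Qed.

Lemma sgen_comm i j : i != j -> sgen j 1 * sgen i 1 = p i j *: (sgen i 1 * sgen j 1).
Proof.
have H (l l' : 'I_n) : skew_coef (delta l 1) (delta l' 1) = if (l' < l)%N then p l' l else 1.
  rewrite /skew_coef (bigD1 l') //= [X in _ * X]big1 ?mulr1; last first.
    move=> i' il; rewrite big1 // => j' _; rewrite !ffunE (negPf il) mulr0 //.
  case: ifP => ll.
    rewrite (bigD1 l) //= big1 ?mulr1 => [|j' /andP[_ jl]]; last first.
      by rewrite !ffunE (negPf jl) mul0r.
    by rewrite !ffunE !eqxx.
  rewrite big1 // => j' lj; rewrite !ffunE; case: eqP => [jl|_]; last by rewrite mul0r.
  by move: lj; rewrite jl ll.
move=> ij; rewrite !smonoM !autv1 !mulr1 -!smonoZ [delta j 1 + _]addrC !H scalerA.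
congr smono; congr (_ *: _).
case: (ltngtP i j) => [||/val_inj e]; last by rewrite e eqxx in ij.
  by rewrite mulr1.
by rewrite (sk_antisym X i j).2 mulVf // (sk_antisym X j i).1.
Qed.

(* t^a = t_1^(a_1) ... t_n^(a_n) *)
Lemma smonoE r a : smono r a = smono r 0 * \prod_(i < n) sgen i (a i).
Proof.
have H (l : seq 'I_n) (b : midx) : sorted ltn [seq nat_of_ord i | i <- l] ->
    \prod_(i <- l) sgen i (b i) = smono 1 (\sum_(i <- l) delta i (b i)).
  elim: l => [|i l IH]; first by rewrite !big_nil.
  rewrite /= => sl; rewrite !big_cons IH ?(path_sorted sl) // smonoM autv1 mulr1.
  rewrite /skew_coef big1 ?scale1r // => i' _; rewrite big1 // => j ij.
  rewrite !ffunE; case: eqP => [ji|_]; last by rewrite mul0r.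
  rewrite sum_ffunE big1_seq ?mulr0 // => j' /andP[_ j'l]; rewrite ffunE.
  case: eqP => // e; move: ij; rewrite ji e.
  have /allP/(_ (j' : nat)) := order_path_min ltn_trans sl.
  by rewrite map_f // => /(_ isT) /ltnW; rewrite leqNgt => /negPf ->.
have -> : \prod_(i < n) sgen i (a i) = smono 1 a.
  rewrite {2}[a]sum_delta H // /index_enum -enumT val_enum_ord; exact: iota_ltn_sorted.
by rewrite smonoM skew_coef0l scale1r autv0 mulr1 add0r.
Qed.

End SkewLaurent.

Arguments smono {k A n} X r a.
Arguments scoef {k A n X} a x.
Arguments sgen {k A n} X i z.

Section Ideals.
Variables (k : fieldType) (A : algType k).

Record tsideal := TSIdeal {
  idset :> A -> Prop;
  id0 : idset 0;
  idD : forall x y, idset x -> idset y -> idset (x + y);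
  idMl : forall r x, idset x -> idset (r * x);
  idMr : forall r x, idset x -> idset (x * r)
}.
Implicit Types (I J K : tsideal) (s t : algAut A).

Lemma tsidealP I J : (forall x, I x <-> J x) -> I = J.
Proof.
case: I J => [I i1 i2 i3 i4] [J j1 j2 j3 j4] /= IJ.
have E : I = J by apply/funext => x; apply/propext.
by case: J / E j1 j2 j3 j4 {IJ} => *; congr TSIdeal; apply: Prop_irrelevance.
Qed.

Lemma idZ I (c : k) x : I x -> I (c *: x).
Proof. by move=> Ix; rewrite -[x]mul1r scalerAl; apply: idMl. Qed.

Lemma id_sum I (T : Type) (r : seq T) (F : T -> A) :
  (forall i, I (F i)) -> I (\sum_(i <- r) F i).
Proof. by move=> IF; apply: big_ind => //; [exact: id0|exact: idD]. Qed.

Definition idfull : tsideal :=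
  @TSIdeal (fun _ => True) I (fun _ _ _ _ => I) (fun _ _ _ => I) (fun _ _ _ => I).

Lemma idlin I c x y : I x -> I y -> I (c *: x + y).
Proof. by move=> Ix; apply: idD; apply: idZ. Qed.

Inductive addspan (V : zmodType) (P : V -> Prop) : V -> Prop :=
| AddSpan0 : addspan P 0
| AddSpanD x y : P x -> addspan P y -> addspan P (x + y).

Lemma addspan_gen (V : zmodType) (P : V -> Prop) x : P x -> addspan P x.
Proof. by move=> Px; rewrite -[x]addr0; apply: AddSpanD => //; apply: AddSpan0. Qed.

Lemma addspan_add (V : zmodType) (P : V -> Prop) x y :
  addspan P x -> addspan P y -> addspan P (x + y).
Proof.
elim=> [|{}x z Px _ IH] Py; first by rewrite add0r.
by rewrite -addrA; apply: AddSpanD => //; apply: IH.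
Qed.

Lemma addspan_map (V W : zmodType) (P : V -> Prop) (Q : W -> Prop) (f : V -> W) :
  f 0 = 0 -> {morph f : x y / x + y} -> (forall x, P x -> addspan Q (f x)) ->
  forall x, addspan P x -> addspan Q (f x).
Proof.
move=> f0 fD PQ x; elim=> [|{}x y Px _ IH]; first by rewrite f0; apply: AddSpan0.
by rewrite fD; apply: addspan_add => //; apply: PQ.
Qed.

Lemma addspan_min I (P : A -> Prop) : (forall x, P x -> I x) -> forall x, addspan P x -> I x.
Proof. by move=> PI x; elim=> [|{}x y /PI Ix _]; [exact: id0|exact: idD]. Qed.

Section Mul.
Variables I J : tsideal.

Definition idprod (z : A) : Prop := exists x y, [/\ I x, J y & z = x * y].

Fact idmul_Ml r x : addspan idprod x -> addspan idprod (r * x).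
Proof.
apply: (addspan_map (f := *%R r)); [exact: mulr0|exact: mulrDr|].
move=> _ [x' [y' [Ix Jy ->]]]; apply: addspan_gen; exists (r * x'), y'.
by split; rewrite ?mulrA //; apply: idMl.
Qed.

Fact idmul_Mr r x : addspan idprod x -> addspan idprod (x * r).
Proof.
apply: (addspan_map (f := *%R^~ r)); [exact: mul0r|by move=> *; rewrite mulrDl|].
move=> _ [x' [y' [Ix Jy ->]]]; apply: addspan_gen; exists x', (y' * r).
by split; rewrite ?mulrA //; apply: idMr.
Qed.

Definition idmul : tsideal :=
  TSIdeal (AddSpan0 idprod) (@addspan_add _ idprod) idmul_Ml idmul_Mr.

Lemma idmul_gen x y : I x -> J y -> idmul (x * y).
Proof. by move=> Ix Jy; apply: addspan_gen; exists x, y. Qed.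

Lemma idmul_min K : (forall x y, I x -> J y -> K (x * y)) -> forall z, idmul z -> K z.
Proof. by move=> IJK; apply: addspan_min => _ [x [y [Ix Jy ->]]]; apply: IJK. Qed.
End Mul.

Lemma idmul_subl I J x : idmul I J x -> I x.
Proof. by apply: idmul_min => {}x y Ix _; apply: idMr. Qed.
Lemma idmul_subr I J x : idmul I J x -> J x.
Proof. by apply: idmul_min => {}x y _ Jy; apply: idMl. Qed.

Lemma idmulS I I' J J' : (forall x, I x -> I' x) -> (forall x, J x -> J' x) ->
  forall x, idmul I J x -> idmul I' J' x.
Proof. by move=> II' JJ'; apply: idmul_min => x y /II' ? /JJ' ?; apply: idmul_gen. Qed.

Fact idmulA : associative idmul.
Proof.
move=> I J K; apply: tsidealP => x; split.
  apply: idmul_min => {}x y Ix JKy; elim: JKy => [|_ y' [u [v [Ju Kv ->]]] _ IH].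
    by rewrite mulr0; apply: id0.
  by rewrite mulrDr; apply: idD => //; rewrite mulrA; do 2?apply: idmul_gen.
apply: idmul_min => {}x y IJx Ky; elim: IJx => [|_ y' [u [v [Ju Kv ->]]] _ IH].
  by rewrite mul0r; apply: id0.
by rewrite mulrDl; apply: idD => //; rewrite -mulrA; do 2?apply: idmul_gen.
Qed.

Fact idmul1l : left_id idfull idmul.
Proof.
move=> I; apply: tsidealP => x; split; first exact: idmul_subr.
by move=> Ix; rewrite -[x]mul1r; apply: idmul_gen.
Qed.

Fact idmul1r : right_id idfull idmul.
Proof.
move=> I; apply: tsidealP => x; split; first exact: idmul_subl.
by move=> Ix; rewrite -[x]mulr1; apply: idmul_gen.
Qed.

HB.instance Definition _ := Monoid.isLaw.Build tsideal idfull idmul idmulA idmul1l idmul1r.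

(* s^z(I) as an ideal; idim s z I x unfolds to (autz s z @` I) x *)
Section Image.
Variables (s : algAut A) (z : int) (I : tsideal).
Let E w := alg_endo_autz s w.

Definition idim_set : A -> Prop := autz s z @` I.

Lemma idim_setP x : idim_set x <-> I (autz s (- z) x).
Proof.
split=> [[y Iy <-]|Ix]; first by rewrite autzN.
by exists (autz s (- z) x) => //; have := autzN s (- z) x; rewrite opprK.
Qed.

Fact idim0 : idim_set 0.
Proof.
apply/idim_setP; case: (E (- z)) => L _ _.
by have -> := linear_map0 L; apply: id0.
Qed.
Fact idimD x y : idim_set x -> idim_set y -> idim_set (x + y).
Proof.
move=> /idim_setP Ix /idim_setP Iy; apply/idim_setP; case: (E (- z)) => L _ _.
by rewrite (linear_mapD _ _ L); apply: idD.
Qed.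
Fact idimMl r x : idim_set x -> idim_set (r * x).
Proof.
by move=> /idim_setP Ix; apply/idim_setP; case: (E (- z)) => _ _ ->; apply: idMl.
Qed.
Fact idimMr r x : idim_set x -> idim_set (x * r).
Proof.
by move=> /idim_setP Ix; apply/idim_setP; case: (E (- z)) => _ _ ->; apply: idMr.
Qed.

Definition idim : tsideal := TSIdeal idim0 idimD idimMl idimMr.
End Image.

Lemma idimP s z I x : idim s z I x <-> I (autz s (- z) x).
Proof. exact: idim_setP. Qed.

Lemma idim_gen s z (I : tsideal) x : I x -> idim s z I (autz s z x).
Proof. by move=> Ix; exists x. Qed.

Lemma idim_0 s I : idim s 0 I = I.
Proof. by apply: tsidealP => x; rewrite idimP oppr0. Qed.

Lemma idim_comp s y z I : idim s y (idim s z I) = idim s (y + z) I.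
Proof. by apply: tsidealP => x; rewrite !idimP -autzD -opprD addrC. Qed.

Lemma idim_full s z : idim s z idfull = idfull.
Proof. by apply: tsidealP => x; rewrite idimP. Qed.

Lemma idim_mul s z I J : idim s z (idmul I J) = idmul (idim s z I) (idim s z J).
Proof.
apply: tsidealP => x; split=> [[{}x IJx <-]|].
  case: (alg_endo_autz s z) => L _ M; elim: IJx => [|_ y [u [v [Iu Jv ->]]] _ IH].
    by have -> := linear_map0 L; apply: id0.
  rewrite (linear_mapD _ _ L); apply: idD => //.
  by rewrite M; apply: idmul_gen; apply: idim_gen.
apply: idmul_min => _ _ [u Iu <-] [v Jv <-].
by case: (alg_endo_autz s z) => _ _ <-; apply/idim_gen/idmul_gen.
Qed.

Lemma idim_comm s t y z I : (forall x, s (t x) = t (s x)) ->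
  idim s y (idim t z I) = idim t z (idim s y I).
Proof. by move=> st; apply: tsidealP => x; rewrite !idimP (autzC _ _ st); split. Qed.

Lemma idim_stable s I z : idim s 1 I = I -> idim s z I = I.
Proof.
move=> sI; have sI' : idim s (-1) I = I by rewrite -[in LHS]sI idim_comp addNr idim_0.
elim: z => [|m IH|m IH]; first exact: idim_0.
  by rewrite intS -idim_comp IH.
by rewrite intS opprD -idim_comp IH.
Qed.

(* I^(z) = J s(J) ... s^(z-1)(J) if z >= 0, s^(-1)(H) ... s^z(H) if z < 0 *)
Definition br_pow s (H J : tsideal) (z : int) : tsideal :=
  match z with
  | Posz m => \big[idmul/idfull]_(j < m) idim s (j : nat)%:Z J
  | Negz m => \big[idmul/idfull]_(j < m.+1) idim s (- j.+1%:Z) H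
  end.

Section Rank1.
Variables (s : algAut A) (H J : tsideal).
Local Notation P := (br_pow s H J).

Lemma idim_big z m (F : 'I_m -> tsideal) :
  idim s z (\big[idmul/idfull]_(j < m) F j) = \big[idmul/idfull]_(j < m) idim s z (F j).
Proof. exact: (big_morph _ (idim_mul s z) (idim_full s z)). Qed.

Lemma br_powSr (m : nat) : P m.+1 = idmul (P m) (idim s m J).
Proof. by rewrite /br_pow big_ord_recr. Qed.

Lemma br_powSl (m : nat) : P m.+1 = idmul J (idim s 1 (P m)).
Proof.
rewrite /br_pow big_ord_recl idim_0 idim_big; congr idmul.
by apply: eq_bigr => j _; rewrite idim_comp.
Qed.

Lemma br_powN (m : nat) : P (- m%:Z) = \big[idmul/idfull]_(j < m) idim s (- j.+1%:Z) H.
Proof. by case: m => [|m] //; rewrite oppr0 /= !big_ord0. Qed.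

Lemma br_powNr (m : nat) : P (- m.+1%:Z) = idmul (P (- m%:Z)) (idim s (- m.+1%:Z) H).
Proof. by rewrite !br_powN big_ord_recr. Qed.

Lemma br_powNl (m : nat) : P (- m.+1%:Z) = idmul (idim s (-1) H) (idim s (-1) (P (- m%:Z))).
Proof.
rewrite !br_powN big_ord_recl idim_big; congr idmul.
by apply: eq_bigr => j _; rewrite idim_comp -opprD -intS.
Qed.

Lemma br_pow_stepl w x : idmul J (idim s 1 (P w)) x -> P (1 + w) x.
Proof.
case: w => [m|m]; first by rewrite -br_powSl.
rewrite !NegzE br_powNl idim_mul !idim_comp subrr !idim_0.
have -> : 1 - m.+1%:Z = - m%:Z by rewrite intS opprD addrA subrr add0r.
by move/idmul_subr/idmul_subr.
Qed.

Lemma br_pow_stepNl w x : idmul (idim s (-1) H) (idim s (-1) (P w)) x -> P (-1 + w) x.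
Proof.
have neg (m : nat) : idmul (idim s (-1) H) (idim s (-1) (P (- m%:Z))) x -> P (-1 - m%:Z) x.
  by rewrite -br_powNl intS opprD.
case: w => [[|m]|m]; [exact: (neg 0)| |exact: (neg m.+1)].
rewrite br_powSl idim_mul idim_comp addNr idim_0 => /idmul_subr/idmul_subr.
by rewrite intS addrA addNr add0r.
Qed.

Lemma br_pow_mul z w x : idmul (P z) (idim s z (P w)) x -> P (z + w) x.
Proof.
elim: z w x => [|m IH|m IH] w x; first by rewrite idim_0 add0r; apply: idmul_subr.
  rewrite br_powSr -idmulA.
  have -> : idim s m.+1 (P w) = idim s m (idim s 1 (P w)).
    by rewrite idim_comp intS addrC.
  rewrite -idim_mul => h; rewrite intS -addrA addrCA; apply: IH.
  move: h; apply: idmulS => // y /idimP/br_pow_stepl Py; exact/idimP.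
rewrite br_powNr -idmulA.
have e : - m.+1%:Z = - m%:Z + -1 by rewrite intS opprD addrC.
rewrite e -!idim_comp -idim_mul -addrA => h; apply: IH.
move: h; apply: idmulS => // y /idimP/br_pow_stepNl Py; exact/idimP.
Qed.
End Rank1.
End Ideals.

Record brData (k : fieldType) (A : algType k) (n : nat) := BRData {
  br_skew :> skewData A n;
  br_H : 'I_n -> tsideal A;
  br_J : 'I_n -> tsideal A;
  br_stableH : forall i j, i != j -> idim (sk_aut br_skew i) 1 (br_H j) = br_H j;
  br_stableJ : forall i j, i != j -> idim (sk_aut br_skew i) 1 (br_J j) = br_J j;
  br_commHH : forall i j, i != j -> idmul (br_H i) (br_H j) = idmul (br_H j) (br_H i);
  br_commHJ : forall i j, i != j -> idmul (br_H i) (br_J j) = idmul (br_J j) (br_H i);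
  br_commJJ : forall i j, i != j -> idmul (br_J i) (br_J j) = idmul (br_J j) (br_J i);
  br_pow_neq0 : forall i z,
    exists2 x, br_pow (sk_aut br_skew i) (br_H i) (br_J i) z x & x != 0
}.

Section BR.
Variables (k : fieldType) (A : algType k) (n : nat) (X : brData A n).
Local Notation midx := {ffun 'I_n -> int}.
Local Notation s := (sk_aut X).
Local Notation H := (br_H X).
Local Notation J := (br_J X).
Implicit Types a b : midx.

(* The canonical ideal I^(a) = I_1^(a_1) ... I_n^(a_n) *)
Definition br_canon a : tsideal A :=
  \big[@idmul k A/idfull A]_(i < n) br_pow (s i) (H i) (J i) (a i).

Local Notation P i z := (br_pow (s i) (H i) (J i) z).

Lemma br_pow_stable i j y z : i != j -> idim (s i) y (P j z) = P j z.
Proof.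
move=> ij.
have st t (I : tsideal A) : idim (s i) 1 I = I -> idim (s i) y (idim (s j) t I) = idim (s j) t I.
  by move=> /(idim_stable y) E; rewrite (idim_comm _ _ _ (sk_comm X i j)) E.
have bigst m (F : 'I_m -> tsideal A) : (forall l, idim (s i) y (F l) = F l) ->
    idim (s i) y (\big[@idmul k A/idfull A]_(l < m) F l) = \big[@idmul k A/idfull A]_(l < m) F l.
  by move=> FE; rewrite idim_big; apply: eq_bigr => l _.
by case: z => m; apply: bigst => l; apply: st; [exact: br_stableJ|exact: br_stableH].
Qed.

Lemma idim_idmulC i j y z (I K : tsideal A) :
  idim (s i) 1 K = K -> idim (s j) 1 I = I -> idmul I K = idmul K I ->
  idmul (idim (s i) y I) (idim (s j) z K) = idmul (idim (s j) z K) (idim (s i) y I).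
Proof.
move=> /(idim_stable y) KE /(idim_stable z) IE IK.
have -> : idim (s j) z K = idim (s i) y (idim (s j) z K).
  by rewrite (idim_comm _ _ _ (sk_comm X i j)) KE.
have -> : idim (s i) y I = idim (s i) y (idim (s j) z I) by rewrite IE.
by rewrite -!idim_mul IK.
Qed.

Lemma idmulC_big (I : tsideal A) (T : Type) (r : seq T) (F : T -> tsideal A) :
  (forall l, idmul I (F l) = idmul (F l) I) ->
  idmul I (\big[@idmul k A/idfull A]_(l <- r) F l) = idmul (\big[@idmul k A/idfull A]_(l <- r) F l) I.
Proof.
move=> FC; elim/big_rec: _ => [|l K _ IH]; first by rewrite idmul1l idmul1r.
by rewrite idmulA FC -idmulA IH idmulA.
Qed.

Lemma br_powC i j y z : i != j -> idmul (P i y) (P j z) = idmul (P j z) (P i y).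
Proof.
move=> ij; have ji : j != i by rewrite eq_sym.
case: z => m; apply: idmulC_big => l; apply/esym;
  case: y => m'; apply: idmulC_big => l'; apply: idim_idmulC;
  by [exact: br_stableH | exact: br_stableJ | exact: br_commHH | exact: br_commJJ
     | exact: br_commHJ | exact/esym/br_commHJ].
Qed.

Lemma idmul_big_swap (r : seq 'I_n) (F G : 'I_n -> tsideal A) : uniq r ->
  (forall i j, i != j -> idmul (F i) (G j) = idmul (G j) (F i)) ->
  idmul (\big[@idmul k A/idfull A]_(i <- r) F i) (\big[@idmul k A/idfull A]_(i <- r) G i) =
  \big[@idmul k A/idfull A]_(i <- r) idmul (F i) (G i).
Proof.
move=> + FG; elim: r => [|i r IH] /=; first by rewrite !big_nil idmul1l.
case/andP=> ir /IH {}IH; rewrite !big_cons -IH -!idmulA; congr idmul.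
rewrite !idmulA; congr idmul.
rewrite -[LHS]idmul1l idmul1l; apply/esym.
elim: r ir {IH} => [|j r IH]; first by rewrite !big_nil idmul1l idmul1r.
rewrite in_cons negb_or => /andP[ij ir]; rewrite !big_cons -idmulA -IH // !idmulA.
by rewrite FG // eq_sym.
Qed.

Lemma big_idmulS (r : seq 'I_n) (F G : 'I_n -> tsideal A) :
  (forall i x, F i x -> G i x) -> forall x,
  (\big[@idmul k A/idfull A]_(i <- r) F i) x -> (\big[@idmul k A/idfull A]_(i <- r) G i) x.
Proof.
move=> FG; elim: r => [|i r IH] x; first by rewrite !big_nil.
by rewrite !big_cons; apply: idmulS => // y; apply: FG.
Qed.

Lemma autv_br_pow a i z x : P i z x -> idim (s i) (a i) (P i z) (autv s a x).
Proof.
rewrite /autv => Px.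
have h r : uniq r -> (if i \in r then idim (s i) (a i) (P i z) else P i z)
    ((\big[comp/id]_(j <- r) autz (s j) (a j)) x).
  elim: r => [|j r IH] /=; first by rewrite big_nil.
  case/andP=> jr /IH {IH}; rewrite big_cons in_cons /= eq_sym.
  case: eqP jr => [<- /negPf -> /= h|/eqP ji jr h]; first exact: idim_gen.
  rewrite /=; case: ifP h => _ h; last first.
    by rewrite -(br_pow_stable (a j) z ji); apply: idim_gen.
  rewrite -(br_pow_stable (a j) z ji) (idim_comm _ _ _ (sk_comm X i j)).
  exact: idim_gen.
by have := h _ (index_enum_uniq _); rewrite mem_index_enum.
Qed.

Lemma canon_autv a b x : br_canon b x ->
  (\big[@idmul k A/idfull A]_(i < n) idim (s i) (a i) (P i (b i))) (autv s a x).
Proof.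
case: (alg_endo_autv s a) => L _ M.
rewrite /br_canon; elim: (index_enum _) x => [|i r IH] x; first by rewrite !big_nil.
rewrite !big_cons; elim=> [|_ y [u [v [Pu Pv ->]]] _ IH'].
  by rewrite (linear_map0 L); apply: id0.
rewrite (linear_mapD _ _ L) M; apply: idD => //; apply: idmul_gen; last exact: IH.
exact: autv_br_pow.
Qed.

Lemma canonM a b x y : br_canon a x -> br_canon b y -> br_canon (a + b) (x * autv s a y).
Proof.
move=> ax /(canon_autv a) bay.
have : idmul (br_canon a) (\big[@idmul k A/idfull A]_(i < n) idim (s i) (a i) (P i (b i)))
         (x * autv s a y) by apply: idmul_gen.
rewrite /br_canon idmul_big_swap ?index_enum_uniq //; last first.
  move=> i j ij; have ji : j != i by rewrite eq_sym.
  have := congr1 (idim (s j) (a j)) (br_powC (a i) (b j) ij).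
  by rewrite !idim_mul (br_pow_stable _ _ ji).
by apply: big_idmulS => i z; rewrite ffunE; apply: br_pow_mul.
Qed.

Lemma canon0 x : br_canon 0 x.
Proof.
rewrite /br_canon (eq_bigr (fun=> idfull A)) => [|i _].
  by elim/big_rec: _ => // i K _ IH; rewrite idmul1l.
by rewrite ffunE /= big_ord0.
Qed.

Definition brpred : {pred slaurent X} := fun x => `[< forall a, br_canon a (scoef a x) >].

Fact brpred_closed : subalg_closed brpred.
Proof.
split=> [|c x y /asboolP Px /asboolP Py|x y /asboolP Px /asboolP Py]; apply/asboolP => a.
- have -> : 1 = smono X 1 0 by [].
  rewrite scoef_mono; case: eqP => [<-|_]; [exact: canon0|exact: id0].
- by rewrite scoefD scoefZ; apply: idlin.
rewrite [x]slaurentE [y]slaurentE mulr_suml scoef_sum.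
apply: id_sum => b; rewrite mulr_sumr scoef_sum; apply: id_sum => c.
rewrite smonoM scoef_mono; case: eqP => [<-|_]; last exact: id0.
by apply: idZ; apply: canonM.
Qed.

HB.instance Definition _ := GRing.isSubalgClosed.Build k (slaurent X) brpred
  (GRing.subalg_closed_semi brpred_closed).

(* R_p(t, sigma, H, J) = \bigoplus_a I^(a) t^a *)
Record brAlg := BRAlg { brval : slaurent X; _ : brval \in brpred }.

HB.instance Definition _ := [isSub for brval].
HB.instance Definition _ := [Choice of brAlg by <:].
HB.instance Definition _ := [SubChoice_isSubAlgebra of brAlg by <:].

(* r t^a; only meaningful for r in I^(a), see brmonoK *)
Definition brmono (r : A) a : brAlg := insubd 0 (smono X r a).

Lemma brmonoK r a : br_canon a r -> val (brmono r a) = smono X r a.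
Proof.
move=> ar; rewrite /brmono insubdK //; apply/asboolP => b; rewrite scoef_mono.
by case: eqP => [<-//|_]; apply: id0.
Qed.

End BR.

Section TensorIdeal.
Variables (k : fieldType) (R S : algType k) (I : tsideal R) (J : tsideal S).

Definition tens_set (z : tensor R S) : Prop :=
  addspan (fun z => exists x y, [/\ I x, J y & z = x *t y]) z.

Fact tens_set_Ml r x : tens_set x -> tens_set (r * x).
Proof.
move=> Ix; move: r; apply: tensor_ind => [u v|c r r' IH IH'].
  move: x Ix; apply: (addspan_map (f := *%R (u *t v))); [exact: mulr0|exact: mulrDr|].
  move=> _ [x [y [Ix Jy ->]]]; apply: addspan_gen; exists (u * x), (v * y).
  by split; rewrite ?tensM //; apply: idMl.
rewrite mulrDl -scalerAl; apply: addspan_add => //.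
move: IH; apply: (addspan_map (f := *:%R c)); [exact: scaler0|exact: scalerDr|].
move=> _ [x' [y [Ix' Jy ->]]]; apply: addspan_gen; exists (c *: x'), y.
by rewrite (linear_mapZ _ _ (tensl_linear y)); split=> //; apply: idZ.
Qed.

Fact tens_set_Mr r x : tens_set x -> tens_set (x * r).
Proof.
move=> Ix; move: r; apply: tensor_ind => [u v|c r r' IH IH'].
  move: x Ix; apply: (addspan_map (f := *%R^~ (u *t v))); [exact: mul0r|by move=> *; rewrite mulrDl|].
  move=> _ [x [y [Ix Jy ->]]]; apply: addspan_gen; exists (x * u), (y * v).
  by split; rewrite ?tensM //; apply: idMr.
rewrite mulrDr -scalerAr; apply: addspan_add => //.
move: IH; apply: (addspan_map (f := *:%R c)); [exact: scaler0|exact: scalerDr|].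
move=> _ [x' [y [Ix' Jy ->]]]; apply: addspan_gen; exists (c *: x'), y.
by rewrite (linear_mapZ _ _ (tensl_linear y)); split=> //; apply: idZ.
Qed.

(* The image of I (x) J in R (x) S *)
Definition tens_ideal : tsideal (tensor R S) :=
  @TSIdeal k (tensor R S) tens_set (AddSpan0 _) (@addspan_add _ _) tens_set_Ml tens_set_Mr.
End TensorIdeal.

(* (f_1, ..., f_m, g_1, ..., g_n) *)
Definition ocat (T : Type) m n (f : 'I_m -> T) (g : 'I_n -> T) (i : 'I_(m + n)) : T :=
  match split i with inl j => f j | inr l => g l end.

Definition alg_iso (k : fieldType) (A B : algType k) : Prop :=
  exists f : {lrmorphism A -> B}, bijective f.

Arguments br_canon {k A n} X a.
Arguments brmono {k A n} X r a.

(* Main.v *)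
Require Import Defs.
From HB Require Import structures.
From mathcomp Require Import all_boot all_order all_algebra.
From mathcomp Require Import boolp classical_sets.

Set Implicit Arguments.
Unset Strict Implicit.
Unset Printing Implicit Defensive.

Import GRing.Theory.

Local Open Scope classical_set_scope.
Local Open Scope ring_scope.

(** Write x^b for the component of x in B at the exponent b. The theorem rests on
    one formula: the products (r u^b)(s v^a), computed in the skew Laurent algebra
    over R (x) S after embedding r as r (x) 1 and s as 1 (x) s, are the monomials
    (r (x) sigma^b(s)) t^(b, a). No scalar appears, because the u-variables precede
    the v-variables in the normal form t^(b, a).

    Both B and D map to the big skew Laurent algebra in this way ([smap]), and
    multiplying in the opposite order gives
      (s v^a)(r u^b) = d_(b, a) (phi^a(r) (x) s) t^(b, a),
    which is exactly the product of the two factors of tau(s v^a (x) r u^b): the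
    twist by sigma^(-b) in tau cancels the sigma^b produced by moving s past u^b.
    The universal property of the twisted tensor product ([tprod_alg_hom]) then
    makes x (x) y |-> x y an algebra homomorphism on B (x)_tau D.

    The image is W, because the canonical ideals of W are the tensor products
    I^(b) (x) I^(a) of those of B and D ([br_canon_tens]), and sigma^b preserves
    I^(a). It is injective because its coefficient at (b, a) is, up to the
    automorphism 1 (x) sigma^b, the tensor product of the coefficient maps
    x |-> x^b and y |-> y^a ([scoef_inM]), and over a field such tensor products
    separate the points of B (x) D when their factors separate the points of B
    and of D ([tensor_slice_eq0]).

    That W is a BR algebra at all needs sigma_i to preserve the ideals K_l, L_l of S
    and phi_l to preserve the ideals H_i, J_i of R. The hypotheses only speak of
    canonical ideals, but L_l and phi_l^(-1)(K_l) are the canonical ideals of D at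
    the exponents e_l and -e_l, and as sigma_i commutes with phi_l, the phi_l^(-1)
    can be removed ([stable_br_HJ]). *)

(** * Algebra homomorphisms *)

Section AlgHom.
Variable k : fieldType.
Implicit Types A B C : algType k.

Definition alg_hom A B (f : A -> B) : Prop :=
  [/\ linear f, f 1 = 1 & {morph f : x y / x * y}].

Lemma alg_hom_comp A B C (f : B -> C) (g : A -> B) :
  alg_hom f -> alg_hom g -> alg_hom (f \o g).
Proof.
move=> [fL f1 fM] [gL g1 gM]; split=> [c x y||x y] /=; first by rewrite gL fL.
  by rewrite g1.
by rewrite gM fM.
Qed.

Lemma alg_hom_bij_iso A B (f : A -> B) :
  alg_hom f -> injective f -> (forall y, exists x, f x = y) -> alg_iso A B.
Proof.
move=> [fL f1 fM] f_inj f_surj.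
pose F : {lrmorphism A -> B} := HB.pack_for {lrmorphism A -> B} f
  (GRing.isLinear.Build k A B *:%R f fL)
  (GRing.isMonoidMorphism.Build A B f (f1, fM)).
exists F; have [g fgK] := choice f_surj.
by exists g => x; [apply: f_inj; rewrite fgK|exact: fgK].
Qed.
End AlgHom.

(** * Tensor products over a field *)

Section TensorSeparation.
Variables (k : fieldType) (U V : lmodType k).

Lemma tensl_inj (v : V) : v != 0 -> injective (fun u : U => u *t v).
Proof.
move=> v0 x y /= xy; apply/eqP; rewrite -subr_eq0; apply: contraT => /tens_neq0/(_ v0).
by rewrite -scaleN1r addrC tensl_linear xy scaleN1r addNr eqxx.
Qed.

Lemma tensr_inj (u : U) : u != 0 -> injective (fun v : V => u *t v).
Proof.
move=> u0 x y /= xy; apply/eqP; rewrite -subr_eq0; apply: contraT => /(tens_neq0 u0).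
by rewrite -scaleN1r addrC tensr_linear xy scaleN1r addNr eqxx.
Qed.

Lemma slice_bil (h : V -> k^o) : linear h -> bilinear_map (fun (u : U) v => h v *: u).
Proof.
move=> lh; split=> [v c x y|u c x y]; first by rewrite scalerDr !scalerA mulrC.
by rewrite lh scalerDl scalerA.
Qed.

Definition slice (h : V -> k^o) : tensor U V -> U := tlift (fun u v => h v *: u).

Lemma slice_linear h : linear h -> linear (slice h).
Proof. by move=> /slice_bil; exact: tlift_linear. Qed.

Lemma sliceE h u v : linear h -> slice h (u *t v) = h v *: u.
Proof. by move=> /slice_bil hb; exact: tliftE hb u v. Qed.

(** Induction on the length of an expression of x as a sum of x_l (x) y_l: a
    nonzero value h(y_l) turns the vanishing slice along h into a linear relation
    expressing x_l by the other x_i, which shortens the expression. *)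
Lemma tensor_slice_eq0 (H : (V -> k^o) -> Prop) :
  (forall h, H h -> linear h) -> (forall v, (forall h, H h -> h v = 0) -> v = 0) ->
  forall x : tensor U V,
    (forall h, H h -> slice h x = 0) -> x = 0.
Proof.
move=> Hlin Hsep x slice0.
suff main N : forall xs : 'I_N -> U, forall ys : 'I_N -> V,
    x = \sum_l xs l *t ys l -> x = 0.
  have [s xE] := tensorE x.
  apply: (main (size s) (fun l => (tnth (in_tuple s) l).1.1 *: (tnth (in_tuple s) l).1.2)
    (fun l => (tnth (in_tuple s) l).2)).
  rewrite {1}xE big_tnth; apply: eq_bigr => l _.
  by rewrite (linear_mapZ _ _ (tensl_linear _)).
elim: N => [|N IH] xs ys xE; first by rewrite xE big_ord0.
have sliceE h : H h -> \sum_l h (ys l) *: xs l = 0.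
  move=> Hh; transitivity (slice h x); last exact: slice0.
  have hL := Hlin h Hh.
  rewrite xE (linear_map_sum _ _ (slice_linear hL)); apply: eq_bigr => l _.
  by rewrite sliceE.
have [y0|] := pselect (forall l, ys l = 0).
  by rewrite xE big1 // => l _; rewrite y0 (linear_map0 (tensr_linear _)).
move=> /existsNP[l yl].
have [h Hh /eqP hl] : exists2 h, H h & h (ys l) <> 0.
  apply: contrapT => nh; apply: yl; apply: Hsep => h Hh.
  by apply: contrapT => hl; apply: nh; exists h.
pose c i := - (h (ys (lift l i)) / h (ys l)).
have xl : xs l = \sum_(i < N) c i *: xs (lift l i).
  have := sliceE h Hh; rewrite (bigD1_ord l) //= => /eqP.
  rewrite addr_eq0 => /eqP/(congr1 (fun u => (h (ys l))^-1 *: u)).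
  rewrite scalerA mulVf // scale1r => ->.
  rewrite scalerN scaler_sumr -sumrN; apply: eq_bigr => i _.
  by rewrite scalerA /c scaleNr mulrC.
apply: (IH (fun i => xs (lift l i)) (fun i => c i *: ys l + ys (lift l i))).
rewrite xE (bigD1_ord l) //= xl (linear_map_sum _ _ (tensl_linear _)) -big_split /=.
apply: eq_bigr => i _; rewrite tensr_linear.
by rewrite (linear_mapZ _ _ (tensl_linear _)).
Qed.
End TensorSeparation.

Section TensorInclusions.
Variables (k : fieldType) (R S : algType k).

Lemma tensl_alg_hom : alg_hom (fun r : R => r *t (1 : S)).
Proof. split; [exact: tensl_linear|exact: tens1|by move=> x y; rewrite tensM mulr1]. Qed.

Lemma tensr_alg_hom : alg_hom (fun s : S => (1 : R) *t s).
Proof. split; [exact: tensr_linear|exact: tens1|by move=> x y; rewrite tensM mulr1]. Qed.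

Lemma tens_split (r : R) (s : S) : r *t s = (r *t 1) * (1 *t s).
Proof. by rewrite tensM mulr1 mul1r. Qed.
End TensorInclusions.

Section TwistedUniversal.
Variables (k : fieldType) (B D A : algType k) (tau : twistingMap B D).
Variables (f : B -> A) (g : D -> A).
Hypotheses (fh : alg_hom f) (gh : alg_hom g).

Definition tprod (x : twisted tau) : A := tlift (fun b d => f b * g d) x.

Lemma tprod_bil : bilinear_map (fun b d => f b * g d).
Proof.
have [fL _ _] := fh; have [gL _ _] := gh.
split=> [d|b] c x y /=; first by rewrite fL mulrDl -scalerAl.
by rewrite gL mulrDr -scalerAr.
Qed.

Lemma tprodE b d : tprod (b *t d) = f b * g d.
Proof. exact: tliftE tprod_bil _ _. Qed.

Lemma tprod_linear : linear tprod.
Proof. exact: tlift_linear tprod_bil. Qed.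

Hypothesis fg : forall b d, g d * f b = tprod (tau (d *t b)).

(** The universal property of the twisted tensor product: only the products of an
    element of D by an element of B, in this order, have to be checked. *)
Lemma tprod_alg_hom : alg_hom tprod.
Proof.
have [_ f1 fM] := fh; have [_ g1 gM] := gh.
have tL := tprod_linear.
have tsand b x d : tprod (sandwich b x d) = f b * tprod x * g d.
  move: x; apply: tensor_ext => [||b' d'].
  - exact: linear_comp tL (sandwich_linear _ _).
  - by move=> c x y; rewrite tL mulrDr mulrDl -scalerAr -scalerAl.
  by rewrite sandwichE !tprodE fM gM !mulrA.
split=> //; first by rewrite tprodE f1 g1 mulr1.
move=> x y; move: x; apply: tensor_ext => [||b d].
- exact: linear_comp tL ((twisted_mul_bilinear tau).1 y).
- by move=> c x z; rewrite tL mulrDl -scalerAl.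
move: y; apply: tensor_ext => [||b' d'].
- exact: linear_comp tL ((twisted_mul_bilinear tau).2 _).
- by move=> c x z; rewrite tL mulrDr -scalerAr.
by rewrite [_ * _](twisted_mulE tau) tsand -fg !tprodE !mulrA.
Qed.
End TwistedUniversal.

(** * Concatenation of families and of exponent vectors *)

Section Concatenation.
Variables (T : Type) (m n : nat) (f : 'I_m -> T) (g : 'I_n -> T).

Lemma ocatl i : ocat f g (lshift n i) = f i.
Proof. by rewrite /ocat (unsplitK (inl i)). Qed.

Lemma ocatr l : ocat f g (rshift m l) = g l.
Proof. by rewrite /ocat (unsplitK (inr l)). Qed.
End Concatenation.

Definition fcat m n (b : {ffun 'I_m -> int}) (a : {ffun 'I_n -> int}) :
  {ffun 'I_(m + n) -> int} := [ffun i => ocat b a i].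

Section Fcat.
Variables m n : nat.
Implicit Types (b : {ffun 'I_m -> int}) (a : {ffun 'I_n -> int}).

Lemma fcatl b a i : fcat b a (lshift n i) = b i.
Proof. by rewrite ffunE ocatl. Qed.

Lemma fcatr b a l : fcat b a (rshift m l) = a l.
Proof. by rewrite ffunE ocatr. Qed.

Lemma fcatD b b' a a' : fcat (b + b') (a + a') = fcat b a + fcat b' a'.
Proof.
by apply/ffunP => i; rewrite !ffunE -(splitK i); case: (split i) => j /=;
  rewrite ?ocatl ?ocatr ffunE.
Qed.

Lemma fcatE (c : {ffun 'I_(m + n) -> int}) :
  c = fcat [ffun i => c (lshift n i)] [ffun l => c (rshift m l)].
Proof.
by apply/ffunP => i; rewrite -(splitK i); case: (split i) => j /=;
  rewrite ?fcatl ?fcatr ffunE.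
Qed.

Lemma fcat_eq b b' a a' : (fcat b a == fcat b' a') = (b == b') && (a == a').
Proof.
apply/eqP/andP => [e|[/eqP-> /eqP->//]].
split; apply/eqP/ffunP => i.
  by rewrite -(fcatl b a) e fcatl.
by rewrite -(fcatr b a) e fcatr.
Qed.
End Fcat.

(** * Powers of automorphisms *)

(** Composition is a monoid law, so that the iterated compositions defining [autv]
    split along a sum of index types. *)
HB.instance Definition _ (T : Type) :=
  Monoid.isLaw.Build (T -> T) id (@comp T T T)
    (fun _ _ _ => erefl) (fun _ => erefl) (fun _ => erefl).

Section Intertwining.
Variables (k : fieldType) (A A' : algType k) (j : A -> A').

Lemma autz_intertwine (s : algAut A) (t : algAut A') :
  (forall x, t (j x) = j (s x)) -> forall z x, autz t z (j x) = j (autz s z x).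
Proof.
move=> tj z x; elim: z => [|z IH|z IH] //; first by rewrite intS !autzS IH tj.
rewrite intS opprD !autzB IH; apply: (can_inj (aut_mapK t)).
by rewrite aut_invK tj aut_invK.
Qed.

Lemma autv_intertwine n (s : 'I_n -> algAut A) (t : 'I_n -> algAut A') :
  (forall i x, t i (j x) = j (s i x)) ->
  forall a x, autv t a (j x) = j (autv s a x).
Proof.
move=> tj a; rewrite /autv.
elim: (index_enum _) => [|i r IH] x; first by rewrite !big_nil.
by rewrite !big_cons /= IH (autz_intertwine (tj i)).
Qed.

Lemma aut_commute_descend n (s : 'I_n -> algAut A) (t : 'I_n -> algAut A') :
  injective j -> (forall i x, t i (j x) = j (s i x)) -> aut_commute t -> aut_commute s.
Proof. by move=> j_inj tj tC i l x; apply: j_inj; rewrite -!tj tC. Qed.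

(** Taken with the inclusions of R and S in R (x) S, this brings the stability
    hypotheses on the lifts down to the tensor factors. *)
Lemma idim_lift_stable (s : algAut A) (t : algAut A') (I : tsideal A) :
  injective j -> (forall x, t (j x) = j (s x)) ->
  t @` [set j x | x in I] = [set j x | x in I] -> idim s 1 I = I.
Proof.
move=> j_inj tj tI; apply: tsidealP => x; split=> [[y Iy <-]|Ix].
  have : [set j x | x in I] (t (j y)) by rewrite -tI; exists (j y) => //; exists y.
  by case=> z Iz; rewrite tj autz1 => /j_inj <-.
have : [set j x | x in I] (j x) by exists x.
by rewrite -tI => -[_ [y Iy <-]]; rewrite tj => /j_inj <-; exists y.
Qed.
End Intertwining.

Section AutProperties.
Variables (k : fieldType) (A : algType k).

Lemma autv_fcat m n (s : 'I_m -> algAut A) (t : 'I_n -> algAut A) b a x :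
  autv (ocat s t) (fcat b a) x = autv s b (autv t a x).
Proof.
rewrite /autv big_split_ord /=.
rewrite (eq_bigr (fun i => autz (s i) (b i))) => [|i _]; last by rewrite ocatl fcatl.
by congr (_ _); rewrite (eq_bigr (fun l => autz (t l) (a l))) // => l _; rewrite ocatr fcatr.
Qed.

(** An ideal is stable as soon as one of its images under a commuting
    automorphism is; this recovers H_i from sigma_i^(-1)(H_i). *)
Lemma idim_stable_comm (s t : algAut A) z (I : tsideal A) :
  (forall x, s (t x) = t (s x)) -> idim s 1 (idim t z I) = idim t z I -> idim s 1 I = I.
Proof.
move=> st; rewrite (idim_comm _ _ _ st) => /(congr1 (idim t (- z))).
by rewrite !idim_comp addNr !idim_0.
Qed.

Lemma autv_stable n (s : 'I_n -> algAut A) (I : tsideal A) a :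
  (forall i, idim (s i) 1 I = I) -> forall x, I x -> I (autv s a x).
Proof.
move=> sI; rewrite /autv; elim/big_rec: _ => //= i f _ IH x Ix.
by rewrite -(idim_stable (a i) (sI i)); apply: idim_gen; apply: IH.
Qed.
End AutProperties.

(** * Ideals of a tensor product *)

Section TensorIdeals.
Variables (k : fieldType) (R S : algType k).
Implicit Types (I : tsideal R) (J : tsideal S).

Lemma tens_ideal_gen I J x y : I x -> J y -> tens_ideal I J (x *t y).
Proof. by move=> Ix Jy; apply: addspan_gen; exists x, y. Qed.

Lemma tens_ideal_min I J (K : tsideal (tensor R S)) :
  (forall x y, I x -> J y -> K (x *t y)) -> forall z, tens_ideal I J z -> K z.
Proof. by move=> IJK; apply: addspan_min => _ [x [y [Ix Jy ->]]]; apply: IJK. Qed.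

Lemma tens_ideal_full : tens_ideal (idfull R) (idfull S) = idfull (tensor R S).
Proof.
apply: tsidealP => z; split=> // _; rewrite -[z]mulr1; apply: idMl.
exact: tens_ideal_gen.
Qed.

Lemma idmul_tens I I' J J' :
  idmul (tens_ideal I J) (tens_ideal I' J') = tens_ideal (idmul I I') (idmul J J').
Proof.
apply: tsidealP => z; split.
  apply: idmul_min => x y IJx IJy; elim: IJx => [|_ x' [u [v [Iu Jv ->]]] _ IH].
    by rewrite mul0r; apply: id0.
  rewrite mulrDl; apply: idD => // {IH}.
  elim: IJy => [|_ y' [u' [v' [Iu' Jv' ->]]] _ IH].
    by rewrite mulr0; apply: id0.
  rewrite mulrDr; apply: idD => //; rewrite tensM.
  by apply: tens_ideal_gen; apply: idmul_gen.
apply: tens_ideal_min => x y Ix; elim=> [|_ y' [v [v' [Jv Jv' ->]]] _ IH].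
  by rewrite (linear_map0 (tensr_linear _)); apply: id0.
rewrite (linear_mapD _ _ (tensr_linear _)); apply: idD => // {IH}.
elim: Ix => [|_ x' [u [u' [Iu Iu' ->]]] _ IH].
  by rewrite (linear_map0 (tensl_linear _)); apply: id0.
rewrite (linear_mapD _ _ (tensl_linear _)); apply: idD => // {IH}.
by rewrite -tensM; apply: idmul_gen; apply: tens_ideal_gen.
Qed.

Lemma idmul_tens_comm I I' J J' :
  idmul I I' = idmul I' I -> idmul J J' = idmul J' J ->
  idmul (tens_ideal I J) (tens_ideal I' J') = idmul (tens_ideal I' J') (tens_ideal I J).
Proof. by move=> IC JC; rewrite !idmul_tens IC JC. Qed.

(** Products of ideals are computed factor by factor, so powers and canonical
    ideals over R (x) S reduce to those over R and over S. *)
Lemma big_idmul_tens (T : Type) (r : seq T) (F : T -> tsideal R) (G : T -> tsideal S) :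
  \big[@idmul k _/idfull _]_(i <- r) tens_ideal (F i) (G i) =
  tens_ideal (\big[@idmul k R/idfull R]_(i <- r) F i)
             (\big[@idmul k S/idfull S]_(i <- r) G i).
Proof.
elim: r => [|i r IH]; first by rewrite !big_nil tens_ideal_full.
by rewrite !big_cons IH idmul_tens.
Qed.

Lemma idmul_fullC (A : algType k) (I : tsideal A) :
  idmul I (idfull A) = idmul (idfull A) I.
Proof. by rewrite idmul1l idmul1r. Qed.

Lemma br_pow_full (A : algType k) (s : algAut A) z :
  br_pow s (idfull A) (idfull A) z = idfull A.
Proof.
have big_full m (F : 'I_m -> int) :
    \big[@idmul k A/idfull A]_(j < m) idim s (F j) (idfull A) = idfull A.
  by elim/big_rec: _ => // j K _ ->; rewrite idim_full idmul1l.
by case: z => m; apply: big_full.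
Qed.

Section TensorAut.
Variables (s : algAut R) (s' : algAut S) (t : algAut (tensor R S)).
Hypotheses (tl : forall r, t (r *t 1) = s r *t 1) (tr : forall r, t (1 *t r) = 1 *t s' r).

Lemma autz_tens z x y : autz t z (x *t y) = autz s z x *t autz s' z y.
Proof.
have [_ _ tM] := alg_endo_autz t z.
rewrite tens_split tM (autz_intertwine (j := fun r => r *t 1) tl).
by rewrite (autz_intertwine (j := fun r => 1 *t r) tr) -tens_split.
Qed.

Lemma idim_tens z I J : idim t z (tens_ideal I J) = tens_ideal (idim s z I) (idim s' z J).
Proof.
apply: tsidealP => w; split=> [[x IJx <-]|].
  elim: IJx => [|_ x' [u [v [Iu Jv ->]]] _ IH].
    by rewrite (linear_map0 (let: And3 L _ _ := alg_endo_autz t z in L)); apply: id0.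
  rewrite (linear_mapD _ _ (let: And3 L _ _ := alg_endo_autz t z in L)).
  by apply: idD => //; rewrite autz_tens; apply: tens_ideal_gen; apply: idim_gen.
apply: tens_ideal_min => _ _ [x Ix <-] [y Jy <-]; rewrite -autz_tens.
by apply: idim_gen; apply: tens_ideal_gen.
Qed.

Lemma br_pow_tens HR JR HS JS z :
  br_pow t (tens_ideal HR HS) (tens_ideal JR JS) z =
  tens_ideal (br_pow s HR JR z) (br_pow s' HS JS z).
Proof.
by case: z => m; rewrite /br_pow -big_idmul_tens; apply: eq_bigr => j _; rewrite idim_tens.
Qed.
End TensorAut.
End TensorIdeals.

Section CanonicalIdeals.
Variables (k : fieldType) (A : algType k) (n : nat) (X : brData A n).

(** All factors but one of a canonical ideal at a multiple of a basis vector are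
    the empty product. *)
Lemma br_canon_delta i z :
  br_canon X (delta i z) = br_pow (sk_aut X i) (br_H X i) (br_J X i) z.
Proof.
rewrite /br_canon.
rewrite (eq_bigr (fun l => if l == i then br_pow (sk_aut X i) (br_H X i) (br_J X i) z
                           else idfull A)); last first.
  by move=> l _; rewrite ffunE; case: eqP => [->|_] //=; rewrite big_ord0.
rewrite -big_mkcond /= -big_filter.
have -> : [seq l <- index_enum 'I_n | l == i] = [:: i]; last by rewrite big_seq1.
exact: (filter_pred1_uniq (index_enum_uniq _) (mem_index_enum i)).
Qed.

Lemma br_canon1 i : br_canon X (delta i 1) = br_J X i.
Proof. by rewrite br_canon_delta /= big_ord_recl big_ord0 idmul1r idim_0. Qed.

Lemma br_canonN1 i : br_canon X (delta i (-1)) = idim (sk_aut X i) (-1) (br_H X i).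
Proof. by rewrite br_canon_delta /= big_ord_recl big_ord0 idmul1r. Qed.

(** Stability of all canonical ideals gives back that of H and J, read off at the
    exponents -1 and 1 of a single variable. *)
Lemma stable_br_HJ (s : algAut A) :
  (forall i x, s (sk_aut X i x) = sk_aut X i (s x)) ->
  (forall a, idim s 1 (br_canon X a) = br_canon X a) ->
  forall i, idim s 1 (br_H X i) = br_H X i /\ idim s 1 (br_J X i) = br_J X i.
Proof.
move=> sC sX i; split; last by rewrite -br_canon1 sX.
by apply: (idim_stable_comm (z := -1) (sC i)); rewrite -br_canonN1 sX.
Qed.
End CanonicalIdeals.

(** * Homomorphisms between skew Laurent algebras *)

Section SkewMap.
Variables (k : fieldType) (A A' : algType k) (n n' : nat).
Variables (X : skewData A n) (Y : skewData A' n').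
Variables (j : A -> A') (e : {ffun 'I_n -> int} -> {ffun 'I_n' -> int}).
Hypotheses (jh : alg_hom j) (eD : {morph e : a b / a + b}).
Hypothesis jE : forall a r, autv (sk_aut Y) (e a) (j r) = j (autv (sk_aut X) a r).
Hypothesis eE : forall a b, skew_coef Y (e a) (e b) = skew_coef X a b.

Definition smap (x : slaurent X) : slaurent Y :=
  sext (fun r a => smono Y (j r) (e a)) x.

Let j0 : j 0 = 0. Proof. by have [jL _ _] := jh; exact: linear_map0. Qed.
Let jD r s : j (r + s) = j r + j s.
Proof. by have [jL _ _] := jh; exact: linear_mapD. Qed.
Let jZ c r : j (c *: r) = c *: j r.
Proof. by have [jL _ _] := jh; exact: linear_mapZ. Qed.

Lemma smap_mono r a : smap (smono X r a) = smono Y (j r) (e a).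
Proof. by apply: sext_mono => b; rewrite j0 smono0. Qed.

Lemma smap0 : smap 0 = 0.
Proof. exact: sext0. Qed.

Lemma smapD : {morph smap : x y / x + y}.
Proof. by apply: sextD => [a|a r s]; rewrite ?j0 ?smono0 // jD smonoD. Qed.

(** Compatibility with the automorphisms and with the commutation scalars is exactly
    what the product of two monomials requires. *)
Lemma smap_alg_hom : alg_hom smap.
Proof.
have [_ j1 jM] := jh; have e0 : e 0 = 0 by apply: (addrI (e 0)); rewrite -eD !addr0.
split.
- move=> c x y; rewrite smapD; congr (_ + _).
  elim/slaurent_ind: x => [|r a x IH]; first by rewrite !(scaler0, smap0).
  by rewrite scalerDr !smapD IH -smonoZ !smap_mono jZ smonoZ scalerDr.
- by rewrite [1]/(smono X 1 0) smap_mono j1 e0.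
move=> x y; elim/slaurent_ind: x => [|r a x IH]; first by rewrite !(mul0r, smap0).
rewrite mulrDl !smapD IH mulrDl; congr (_ + _); clear x IH.
elim/slaurent_ind: y => [|s b y IH]; first by rewrite !(mulr0, smap0).
rewrite mulrDr !smapD IH mulrDr; congr (_ + _).
by rewrite smonoM !smap_mono smonoM eE jE jZ jM eD.
Qed.
End SkewMap.

(** Reordering t^(b, a) t^(b', a') only moves u-variables past u-variables,
    v-variables past v-variables, and u^b' to the left of v^a; the v-variables of
    the second factor never cross the u-variables of the first. *)
Lemma skew_coef_fcat (k : fieldType) (A A1 A2 : algType k) (m n : nat)
    (X : skewData A1 m) (Y : skewData A2 n) (Z : skewData A (m + n)) d d' :
  sk_p Z = block_mx (sk_p X) d d' (sk_p Y) -> forall b b' a a',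
  skew_coef Z (fcat b a) (fcat b' a') =
    skew_coef X b b' * skew_coef Y a a' *
      \prod_(i < m) \prod_(l < n) d i l ^ (b' i * a l).
Proof.
move=> pE b b' a a'; rewrite /skew_coef big_split_ord /= mulrAC; congr (_ * _).
  rewrite -big_split; apply: eq_bigr => i _; rewrite big_split_ord /=; congr (_ * _).
    by apply: eq_bigr => l _; rewrite pE block_mxEul !fcatl.
  rewrite (eq_bigl xpredT) => [|l].
    by apply: eq_bigr => l _; rewrite pE block_mxEur fcatl fcatr mulrC.
  by rewrite /= (leq_trans (ltn_ord i)) // leq_addr.
apply: eq_bigr => i _; rewrite big_split_ord /= big_pred0 ?mul1r => [|l].
  apply: eq_big => [l|l _]; first by rewrite /= ltn_add2l.
  by rewrite pE block_mxEdr !fcatr.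
by rewrite /= ltnNge (leq_trans (ltnW (ltn_ord l))) ?leq_addr.
Qed.

Lemma mult_antisym_block (k : fieldType) m n (p : 'M[k]_m) (q : 'M[k]_n) (d : 'M[k]_(m, n)) :
  mult_antisym p -> mult_antisym q -> (forall i l, d i l != 0) ->
  mult_antisym (block_mx p d (\matrix_(l, i) (d i l)^-1) q).
Proof.
move=> pA qA d0 i j; rewrite -(splitK i) -(splitK j).
case: (split i) => i'; case: (split j) => j' /=.
- by rewrite !block_mxEul.
- by rewrite block_mxEur block_mxEdl mxE invrK.
- by rewrite block_mxEur block_mxEdl mxE invr_eq0.
by rewrite !block_mxEdr.
Qed.

Section BrAlgMonomials.
Variables (k : fieldType) (A : algType k) (n : nat) (X : brData A n).

Lemma brAlg_canon (x : brAlg X) a : br_canon X a (scoef a (val x)).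
Proof. by case: x => x /= /asboolP. Qed.

Lemma brAlgE (x : brAlg X) :
  exists s : seq {ffun 'I_n -> int}, x = \sum_(a <- s) brmono X (scoef a (val x)) a.
Proof.
have [s xE] : exists s, val x = \sum_(a <- s) smono X (scoef a (val x)) a.
  by eexists; exact: slaurentE.
exists s; apply: val_inj; rewrite raddf_sum /= {1}xE; apply: eq_bigr => a _.
by rewrite brmonoK //; exact: brAlg_canon.
Qed.

Lemma brAlg_ext (V : lmodType k) (f g : brAlg X -> V) :
  linear f -> linear g ->
  (forall r a, br_canon X a r -> f (brmono X r a) = g (brmono X r a)) -> f =1 g.
Proof.
move=> fL gL fg x; have [s ->] := brAlgE x.
rewrite !linear_map_sum //; apply: eq_bigr => a _; exact/fg/brAlg_canon.
Qed.

Lemma brval_alg_hom : alg_hom (val : brAlg X -> slaurent X).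
Proof. by split; [exact: linearP|exact: rmorph1|exact: rmorphM]. Qed.

Lemma scoef_linear a : linear (fun x : slaurent X => scoef a x).
Proof. by move=> c x y; rewrite scoefD scoefZ. Qed.
End BrAlgMonomials.

(** * The tensor product of two BR data *)

Section TensorData.
Variables (k : fieldType) (R S : algType k) (m n : nat).
Variables (B : brData R m) (D : brData S n).
Variables (sT : 'I_m -> algAut (tensor R S)) (fT : 'I_n -> algAut (tensor R S)).
Variables (sS : 'I_m -> algAut S) (fR : 'I_n -> algAut R).
Variable d : 'M[k]_(m, n).
Hypotheses (sTl : forall i (r : R), sT i (r *t 1) = sk_aut B i r *t 1)
  (sTr : forall i (s : S), sT i (1 *t s) = 1 *t sS i s)
  (fTl : forall l (r : R), fT l (r *t 1) = fR l r *t 1)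
  (fTr : forall l (s : S), fT l (1 *t s) = 1 *t sk_aut D l s)
  (sfT_comm : aut_commute (ocat sT fT))
  (sS_canon : forall i a, idim (sS i) 1 (br_canon D a) = br_canon D a)
  (fR_canon : forall l b, idim (fR l) 1 (br_canon B b) = br_canon B b)
  (d_neq0 : forall i l, d i l != 0).

Let tens1l_inj : injective (fun r : R => r *t (1 : S)).
Proof. exact: tensl_inj (oner_neq0 S). Qed.
Let tens1r_inj : injective (fun s : S => (1 : R) *t s).
Proof. exact: tensr_inj (oner_neq0 R). Qed.

Lemma sS_comm : aut_commute sS.
Proof.
apply: (aut_commute_descend tens1r_inj sTr) => i i' x.
by have := sfT_comm (lshift n i) (lshift n i') x; rewrite !ocatl.
Qed.

Let sTfT i l x : sT i (fT l x) = fT l (sT i x).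
Proof. by have := sfT_comm (lshift n i) (rshift m l) x; rewrite ocatl ocatr. Qed.

Let sSD i l x : sS i (sk_aut D l x) = sk_aut D l (sS i x).
Proof. by apply: tens1r_inj; rewrite /= -sTr -!fTr -sTr sTfT. Qed.

Let fRB l i x : fR l (sk_aut B i x) = sk_aut B i (fR l x).
Proof. by apply: tens1l_inj; rewrite /= -fTl -!sTl -fTl sTfT. Qed.

Definition tens_skew : skewData (tensor R S) (m + n) :=
  @SkewData k (tensor R S) (m + n) (block_mx (sk_p B) d (\matrix_(l, i) (d i l)^-1) (sk_p D))
    (ocat sT fT) (mult_antisym_block (@sk_antisym _ _ _ B) (@sk_antisym _ _ _ D) d_neq0) sfT_comm.

Definition tens_H := ocat (fun i => tens_ideal (br_H B i) (idfull S))
                          (fun l => tens_ideal (idfull R) (br_H D l)).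
Definition tens_J := ocat (fun i => tens_ideal (br_J B i) (idfull S))
                          (fun l => tens_ideal (idfull R) (br_J D l)).

Let ord_case (P : 'I_(m + n) -> Prop) :
  (forall i, P (lshift n i)) -> (forall l, P (rshift m l)) -> forall i, P i.
Proof. by move=> Pl Pr i; rewrite -(splitK i); case: (split i). Qed.

Lemma tens_stable (F : 'I_m -> tsideal R) (G : 'I_n -> tsideal S) :
  (forall i i', i != i' -> idim (sk_aut B i) 1 (F i') = F i') ->
  (forall i l, idim (sS i) 1 (G l) = G l) ->
  (forall l i, idim (fR l) 1 (F i) = F i) ->
  (forall l l', l != l' -> idim (sk_aut D l) 1 (G l') = G l') ->
  let I := ocat (fun i => tens_ideal (F i) (idfull S)) (fun l => tens_ideal (idfull R) (G l)) in
  forall i j, i != j -> idim (sk_aut tens_skew i) 1 (I j) = I j.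
Proof.
move=> BF sG fF DG /=; apply: ord_case => i; apply: ord_case => j;
  rewrite ?ocatl ?ocatr ?(inj_eq (@lshift_inj _ _)) ?(inj_eq (@rshift_inj _ _)) => ij.
- by rewrite (idim_tens (sTl i) (sTr i)) idim_full BF.
- by rewrite (idim_tens (sTl i) (sTr i)) idim_full sG.
- by rewrite (idim_tens (fTl i) (fTr i)) idim_full fF.
by rewrite (idim_tens (fTl i) (fTr i)) idim_full DG.
Qed.

Lemma tens_comm (F F' : 'I_m -> tsideal R) (G G' : 'I_n -> tsideal S) :
  (forall i i', i != i' -> idmul (F i) (F' i') = idmul (F' i') (F i)) ->
  (forall l l', l != l' -> idmul (G l) (G' l') = idmul (G' l') (G l)) ->
  let I := ocat (fun i => tens_ideal (F i) (idfull S)) (fun l => tens_ideal (idfull R) (G l)) in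
  let I' := ocat (fun i => tens_ideal (F' i) (idfull S)) (fun l => tens_ideal (idfull R) (G' l)) in
  forall i j, i != j -> idmul (I i) (I' j) = idmul (I' j) (I i).
Proof.
move=> FF GG /=; apply: ord_case => i; apply: ord_case => j;
  rewrite ?ocatl ?ocatr ?(inj_eq (@lshift_inj _ _)) ?(inj_eq (@rshift_inj _ _)) => ij;
  apply: idmul_tens_comm; by [exact: FF | exact: GG | exact: idmul_fullC | exact/esym/idmul_fullC].
Qed.

Lemma br_pow_tensl i z :
  br_pow (ocat sT fT (lshift n i)) (tens_H (lshift n i)) (tens_J (lshift n i)) z =
  tens_ideal (br_pow (sk_aut B i) (br_H B i) (br_J B i) z) (idfull S).
Proof. by rewrite /tens_H /tens_J !ocatl (br_pow_tens (sTl i) (sTr i)) br_pow_full. Qed.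

Lemma br_pow_tensr l z :
  br_pow (ocat sT fT (rshift m l)) (tens_H (rshift m l)) (tens_J (rshift m l)) z =
  tens_ideal (idfull R) (br_pow (sk_aut D l) (br_H D l) (br_J D l) z).
Proof. by rewrite /tens_H /tens_J !ocatr (br_pow_tens (fTl l) (fTr l)) br_pow_full. Qed.

Lemma tens_pow_neq0 i z :
  exists2 x, br_pow (sk_aut tens_skew i) (tens_H i) (tens_J i) z x & x != 0.
Proof.
move: i; apply: ord_case => i.
  have [x Px x0] := br_pow_neq0 B i z; exists (x *t 1); last exact/tens_neq0/oner_neq0.
  by rewrite br_pow_tensl; apply: tens_ideal_gen.
have [x Px x0] := br_pow_neq0 D i z; exists (1 *t x); last exact/tens_neq0/x0/oner_neq0.
by rewrite br_pow_tensr; apply: tens_ideal_gen.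
Qed.

Let BHJ l i := stable_br_HJ (fRB l) (fR_canon l) i.
Let DHJ i l := stable_br_HJ (sSD i) (sS_canon i) l.

Definition tens_data : brData (tensor R S) (m + n) :=
  @BRData k (tensor R S) (m + n) tens_skew tens_H tens_J
    (tens_stable (@br_stableH _ _ _ B) (fun i l => (DHJ i l).1) (fun l i => (BHJ l i).1)
       (@br_stableH _ _ _ D))
    (tens_stable (@br_stableJ _ _ _ B) (fun i l => (DHJ i l).2) (fun l i => (BHJ l i).2)
       (@br_stableJ _ _ _ D))
    (tens_comm (@br_commHH _ _ _ B) (@br_commHH _ _ _ D))
    (tens_comm (@br_commHJ _ _ _ B) (@br_commHJ _ _ _ D))
    (tens_comm (@br_commJJ _ _ _ B) (@br_commJJ _ _ _ D))
    tens_pow_neq0.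

Local Notation W := tens_data.

(** In each factor of a canonical ideal one of the two tensor components is the
    whole algebra, which is neutral for products of ideals. *)
Lemma br_canon_tens b a :
  br_canon W (fcat b a) = tens_ideal (br_canon B b) (br_canon D a).
Proof.
rewrite /br_canon big_split_ord /=.
under eq_bigr do rewrite fcatl br_pow_tensl.
under [X in idmul _ X]eq_bigr do rewrite fcatr br_pow_tensr.
rewrite !big_idmul_tens idmul_tens.
have big_full p A : \big[@idmul k A/idfull A]_(i < p) idfull A = idfull A.
  by elim/big_rec: _ => // i K _ ->; rewrite idmul1l.
by rewrite !big_full idmul1l idmul1r.
Qed.

Local Notation dcoef b a := (\prod_(i < m) \prod_(l < n) d i l ^ (b i * a l)).

Lemma skew_coef_tens b b' a a' :
  skew_coef W (fcat b a) (fcat b' a') = skew_coef B b b' * skew_coef D a a' * dcoef b' a.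
Proof. exact: skew_coef_fcat. Qed.

Lemma dcoef0l a : dcoef (0 : {ffun 'I_m -> int}) a = 1.
Proof. by rewrite big1 // => i _; rewrite big1 // => l _; rewrite ffunE mul0r. Qed.

Lemma dcoef0r b : dcoef b (0 : {ffun 'I_n -> int}) = 1.
Proof. by rewrite big1 // => i _; rewrite big1 // => l _; rewrite ffunE mulr0. Qed.

Lemma autv_tensl b a r :
  autv (sk_aut W) (fcat b a) (r *t 1) = autv (sk_aut B) b (autv fR a r) *t 1.
Proof.
by rewrite autv_fcat (autv_intertwine (j := fun r => r *t 1) fTl)
  (autv_intertwine (j := fun r => r *t 1) sTl).
Qed.

Lemma autv_tensr b a s :
  autv (sk_aut W) (fcat b a) (1 *t s) = 1 *t autv sS b (autv (sk_aut D) a s).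
Proof.
by rewrite autv_fcat (autv_intertwine (j := fun s => 1 *t s) fTr)
  (autv_intertwine (j := fun s => 1 *t s) sTr).
Qed.

Definition inB : slaurent B -> slaurent W :=
  smap (X := B) W (fun r => r *t 1) (fun b => fcat b 0).
Definition inD : slaurent D -> slaurent W :=
  smap (X := D) W (fun s => 1 *t s) (fun a => fcat 0 a).

Lemma inB_mono r b : inB (smono B r b) = smono W (r *t 1) (fcat b 0).
Proof. exact/smap_mono/tensl_alg_hom. Qed.

Lemma inD_mono s a : inD (smono D s a) = smono W (1 *t s) (fcat 0 a).
Proof. exact/smap_mono/tensr_alg_hom. Qed.

Lemma inB_alg_hom : alg_hom inB.
Proof.
apply: smap_alg_hom => [|b b'|b r|b b']; first exact: tensl_alg_hom.
- by rewrite -fcatD addr0.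
- by rewrite autv_tensl autv0.
by rewrite skew_coef_tens skew_coef0l dcoef0r !mulr1.
Qed.

Lemma inD_alg_hom : alg_hom inD.
Proof.
apply: smap_alg_hom => [|a a'|a s|a a']; first exact: tensr_alg_hom.
- by rewrite -fcatD addr0.
- by rewrite autv_tensr autv0.
by rewrite skew_coef_tens skew_coef0l dcoef0l mul1r mulr1.
Qed.

(** The scalar is 1 since u^b already stands to the left of v^a. *)
Lemma inM r b s a : inB (smono B r b) * inD (smono D s a) =
  smono W (r *t autv sS b s) (fcat b a).
Proof.
rewrite inB_mono inD_mono smonoM skew_coef_tens skew_coef0r skew_coef0l dcoef0l.
by rewrite !mulr1 scale1r autv_tensr autv0 tensM mulr1 mul1r -fcatD addr0 add0r.
Qed.

(** The relation that tau encodes: sigma^(-b) in the definition of tau cancels the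
    sigma^b that arises when s crosses u^b. *)
Lemma inM_swap r b s a : inD (smono D s a) * inB (smono B r b) =
  dcoef b a *: (inB (smono B (autv fR a r) b) * inD (smono D (autv sS (- b) s) a)).
Proof.
have sSK := autvN sS_comm (- b) s; rewrite opprK in sSK.
rewrite inM sSK.
rewrite inB_mono inD_mono smonoM skew_coef_tens skew_coef0l skew_coef0r !mul1r.
by rewrite autv_tensl autv0 tensM mul1r mulr1 -fcatD addr0 add0r smonoZ.
Qed.




(** Only the monomials at b and at a contribute, because the exponents of two
    monomials can be read off the exponent of their product. *)
Lemma scoef_inM x y b a :
  scoef (fcat b a) (inB x * inD y) = scoef b x *t autv sS b (scoef a y).
Proof.
have [lL _ _] := inB_alg_hom; have [rL _ _] := inD_alg_hom.
have [sL _ _] := alg_endo_autv sS b.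
elim/slaurent_ind: x => [|r b' x IH].
  by rewrite (linear_map0 lL) mul0r !scoef0 (linear_map0 (tensl_linear _)).
rewrite (linear_mapD _ _ lL) mulrDl !scoefD IH (linear_mapD _ _ (tensl_linear _)).
congr (_ + _); clear x IH; elim/slaurent_ind: y => [|s a' y IH].
  rewrite (linear_map0 rL) mulr0 !scoef0 (linear_map0 sL).
  by rewrite (linear_map0 (tensr_linear _)).
rewrite (linear_mapD _ _ rL) mulrDr !scoefD IH (linear_mapD _ _ sL).
rewrite (linear_mapD _ _ (tensr_linear _)); congr (_ + _).
rewrite inM !scoef_mono fcat_eq; case: eqP => [->|_] /=; last first.
  by rewrite (linear_map0 (tensl_linear _)).
by case: eqP => // _; rewrite (linear_map0 sL) (linear_map0 (tensr_linear _)).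
Qed.

Section Iso.
Variable tau : twistingMap (brAlg B) (brAlg D).
Hypothesis tauE : forall a b s r, br_canon D a s -> br_canon B b r ->
  tau (brmono D s a *t brmono B r b) =
    dcoef b a *: (brmono B (autv fR a r) b *t brmono D (autv sS (- b) s) a).

Let f : brAlg B -> slaurent W := inB \o val.
Let g : brAlg D -> slaurent W := inD \o val.

Let fh : alg_hom f.
Proof. exact: (alg_hom_comp inB_alg_hom (brval_alg_hom _)). Qed.
Let gh : alg_hom g.
Proof. exact: (alg_hom_comp inD_alg_hom (brval_alg_hom _)). Qed.

Definition twisted_map : twisted tau -> slaurent W := tprod f g.

Lemma twisted_map_alg_hom : alg_hom twisted_map.
Proof.
have [fL _ _] := fh; have [gL _ _] := gh; have tL := tprod_linear (tau := tau) fh gh.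
apply: tprod_alg_hom => // x y; move: y.
apply: brAlg_ext => [c y z|c y z|s a Ds].
- by rewrite gL mulrDl -scalerAl.
- by rewrite tensl_linear linearP tL.
move: x; apply: brAlg_ext => [c y z|c y z|r b Br].
- by rewrite fL mulrDr -scalerAr.
- by rewrite tensr_linear linearP tL.
have Br' : br_canon B b (autv fR a r) by apply: autv_stable => // l; exact: fR_canon.
have Ds' : br_canon D a (autv sS (- b) s) by apply: autv_stable => // i; exact: sS_canon.
rewrite tauE // (linear_mapZ _ _ tL) tprodE // /f /g /= !brmonoK //.
exact: inM_swap.
Qed.

Lemma twisted_mapE x y : twisted_map (x *t y) = inB (val x) * inD (val y).
Proof. exact: tprodE. Qed.

Lemma twisted_map_in z : twisted_map z \in brpred (X := W).
Proof.
have tL := tprod_linear (tau := tau) fh gh.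
apply/asboolP => c; move: z; apply: tensor_ind => [x y|e x y IHx IHy]; last first.
  by rewrite /twisted_map tL scoefD scoefZ; apply: idlin.
rewrite (fcatE c) twisted_mapE scoef_inM br_canon_tens; apply: tens_ideal_gen.
  exact: brAlg_canon.
by apply: autv_stable => [i|]; [exact: sS_canon|exact: brAlg_canon].
Qed.

(** It suffices to kill every slice of z along a functional of the form
    phi(y^a) on D, and that slice only needs its components in B to vanish. Each
    of them is a slice of the coefficient of the image of z at (b, a), along phi
    composed with sigma^(-b). *)
Lemma twisted_map_eq0 z : twisted_map z = 0 -> z = 0.
Proof.
have tL : linear twisted_map := tprod_linear (tau := tau) fh gh.
move=> z0.
pose H (h : brAlg D -> k^o) :=
  exists a (phi : {linear S -> k^o}), h = fun y => phi (scoef a (val y)).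
have HL h : H h -> linear h.
  by move=> [a [phi ->]] c x y; rewrite linearP scoef_linear linearP.
apply: (tensor_slice_eq0 (H := H)) => // [y y0|h Hh].
  apply: val_inj; apply/slaurentP => a; rewrite scoef0.
  apply: contrapT => /eqP/exists_functional[phi phi1].
  have := y0 _ (ex_intro _ a (ex_intro _ phi erefl)); rewrite phi1 => /eqP.
  by rewrite oner_eq0.
have hL := HL h Hh; have [a [phi hE]] := Hh.
apply: val_inj; apply/slaurentP => b; rewrite scoef0.
have [sL _ _] := alg_endo_autv sS (- b).
pose psi s := phi (autv sS (- b) s).
have psiL : linear psi by move=> c x y; rewrite /psi sL linearP.
suff E z' : scoef b (val (slice h z')) = slice psi (scoef (fcat b a) (twisted_map z')).
  by rewrite E z0 scoef0 (linear_map0 (slice_linear psiL)).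
move: z'; apply: tensor_ext => [c x y|c x y|x y].
- by rewrite (slice_linear hL) linearP scoef_linear.
- by rewrite tL scoef_linear (slice_linear psiL).
rewrite sliceE // twisted_mapE scoef_inM sliceE //.
by rewrite linearZ scoefZ hE /psi (autvN sS_comm).
Qed.

(** A monomial (r (x) s) t^(b, a) is hit by r u^b (x) sigma^(-b)(s) v^a, and
    sigma^(-b)(s) stays in the canonical ideal of s. *)
Lemma twisted_map_surj (w : brAlg W) : exists z, twisted_map z = val w.
Proof.
have tL : linear twisted_map := tprod_linear (tau := tau) fh gh.
have sumE y z : twisted_map (y + z) = twisted_map y + twisted_map z.
  exact: linear_mapD.
have [s ->] := brAlgE w.
apply: (big_ind (fun w => exists z, twisted_map z = val w)) => [|u v [y yE] [z zE]|c _].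
- by exists 0; exact: linear_map0.
- by exists (y + z); rewrite sumE; congr (_ + _).
have := brAlg_canon w c; set u := scoef _ _ => cu; rewrite /= brmonoK //.
move: cu; rewrite (fcatE c); set b := finfun _; set a := finfun _.
rewrite br_canon_tens; elim=> [|_ u' [r [s' [Br Ds ->]]] _ [z zE]].
  by exists 0; rewrite smono0; exact: linear_map0.
have Ds' : br_canon D a (autv sS (- b) s') by apply: autv_stable => // i; exact: sS_canon.
exists (brmono B r b *t brmono D (autv sS (- b) s') a + z).
rewrite sumE zE smonoD twisted_mapE !brmonoK // inM.
by have := autvN sS_comm (- b) s'; rewrite opprK => ->.
Qed.

Lemma twisted_alg_iso : alg_iso (twisted tau) (brAlg W).
Proof.
have [tL t1 tM] := twisted_map_alg_hom.
pose F z : brAlg W := BRAlg (twisted_map_in z).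
apply: (@alg_hom_bij_iso _ _ _ F) => [|x y /(congr1 val) /= xy|w].
- by split=> [c x y||x y]; apply: val_inj; rewrite /= ?tL ?t1 ?tM.
- apply/eqP; rewrite -subr_eq0; apply/eqP/twisted_map_eq0.
  by rewrite -scaleN1r addrC tL xy scaleN1r addNr.
by have [z zE] := twisted_map_surj w; exists z; apply: val_inj.
Qed.
End Iso.
End TensorData.

(** * The isomorphism theorem *)

Theorem theorem4p6 (k : fieldType) (R S : algType k) (m n : nat)
  (B : brData R m) (D : brData S n)
  (* the lifts of sigma_i and phi_l to automorphisms of R (x) S *)
  (sT : 'I_m -> algAut (tensor R S)) (fT : 'I_n -> algAut (tensor R S))
  (sT_lift : forall i (r : R), sT i (r *t 1) = sk_aut B i r *t 1)
  (fT_lift : forall l (s : S), fT l (1 *t s) = 1 *t sk_aut D l s)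
  (sT_canon : forall i (a : {ffun 'I_n -> int}),
     sT i @` [set 1 *t s | s in br_canon D a] = [set (1 : R) *t s | s in br_canon D a])
  (fT_canon : forall l (b : {ffun 'I_m -> int}),
     fT l @` [set r *t 1 | r in br_canon B b] = [set r *t (1 : S) | r in br_canon B b])
  (sfT_comm : aut_commute (ocat sT fT))
  (* their restrictions to 1 (x) S and R (x) 1 *)
  (sS : 'I_m -> algAut S) (fR : 'I_n -> algAut R)
  (sS_restr : forall i (s : S), sT i (1 *t s) = 1 *t sS i s)
  (fR_restr : forall l (r : R), fT l (r *t 1) = fR l r *t 1)
  (d : 'M[k]_(m, n)) (d_neq0 : forall i l, d i l != 0)
  (tau : twistingMap (brAlg B) (brAlg D))
  (tauE : forall (a : {ffun 'I_n -> int}) (b : {ffun 'I_m -> int}) (s : S) (r : R),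
     br_canon D a s -> br_canon B b r ->
     tau (brmono D s a *t brmono B r b) =
       (\prod_(i < m) \prod_(l < n) d i l ^ (b i * a l)) *:
         (brmono B (autv fR a r) b *t brmono D (autv sS (- b) s) a)) :
  exists2 W : brData (tensor R S) (m + n),
    [/\ sk_p W = block_mx (sk_p B) d (\matrix_(l, i) (d i l)^-1) (sk_p D),
        sk_aut W = ocat sT fT,
        br_H W = ocat (fun i => tens_ideal (br_H B i) (idfull S))
                      (fun l => tens_ideal (idfull R) (br_H D l))
      & br_J W = ocat (fun i => tens_ideal (br_J B i) (idfull S))
                      (fun l => tens_ideal (idfull R) (br_J D l))]
    & alg_iso (twisted tau) (brAlg W).
Proof.
have sS_canon i a : idim (sS i) 1 (br_canon D a) = br_canon D a.
  exact: idim_lift_stable (tensr_inj (oner_neq0 R)) (sS_restr i) (sT_canon i a).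
have fR_canon l b : idim (fR l) 1 (br_canon B b) = br_canon B b.
  exact: idim_lift_stable (tensl_inj (oner_neq0 S)) (fR_restr l) (fT_canon l b).
exists (tens_data sT_lift sS_restr fR_restr fT_lift sfT_comm sS_canon fR_canon d_neq0).
  by split.
exact: twisted_alg_iso.
Qed.
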